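(* Let $\mathbf{A}$ be a finite, semisimple, solvable algebra. If $d_{\mathbf{A}}(n)\in O(n)$, then $\mathbf{A}$ has a Maltsev polynomial, and so it is affine.
   Context: $d_{\mathbf{A}}(n)$ is the least size of a generating set of $\mathbf{A}^n$. Semisimple: isomorphic to a subdirect product of simple algebras (equivalently, the maximal congruences intersect to $0$). Solvability is with respect to the term condition commutator. A Maltsev polynomial is a polynomial $m$ with $m(x,y,y)=x=m(y,y,x)$; affine means abelian with a Maltsev term. *)

(* Defs.v *)
From mathcomp Require Import all_boot.
From Stdlib Require Import ClassicalEpsilon.

Set Implicit Arguments.
Unset Strict Implicit.
Unset Printing Implicit Defensive.

Record algebra := Algebra {
  carrier : finType;
  sym : Type;
  arity : sym -> nat;
  op : forall s : sym, ('I_(arity s) -> carrier) -> carrier }.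

Section UA.
Variable A : algebra.
Local Notation T := (carrier A).

Inductive is_term (k : nat) : (('I_k -> T) -> T) -> Prop :=
| term_proj (j : 'I_k) : is_term (fun x => x j)
| term_op (s : sym A) (g : 'I_(arity s) -> (('I_k -> T) -> T)) :
    (forall j, is_term (g j)) -> is_term (fun x => op (fun j => g j x)).

Inductive is_poly (k : nat) : (('I_k -> T) -> T) -> Prop :=
| poly_proj (j : 'I_k) : is_poly (fun x => x j)
| poly_const (c : T) : is_poly (fun _ => c)
| poly_op (s : sym A) (g : 'I_(arity s) -> (('I_k -> T) -> T)) :
    (forall j, is_poly (g j)) -> is_poly (fun x => op (fun j => g j x)).

Definition trip (x y z : T) : 'I_3 -> T := fun i => nth x [:: x; y; z] i.

Definition is_maltsev (m : ('I_3 -> T) -> T) : Prop :=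
  forall x y : T, m (trip x y y) = x /\ m (trip y y x) = x.

Definition has_maltsev_poly : Prop := exists m, is_poly m /\ is_maltsev m.
Definition has_maltsev_term : Prop := exists m, is_term m /\ is_maltsev m.

Definition is_cong (r : T -> T -> Prop) : Prop :=
  [/\ (forall x, r x x), (forall x y, r x y -> r y x),
      (forall x y z, r x y -> r y z -> r x z) &
      (forall (s : sym A) (a b : 'I_(arity s) -> T),
          (forall j, r (a j) (b j)) -> r (op a) (op b))].

Definition total_rel (x y : T) : Prop := True.

Definition is_maximal_cong (th : T -> T -> Prop) : Prop :=
  [/\ is_cong th, (exists x y, ~ th x y) &
      forall psi, is_cong psi -> (forall x y, th x y -> psi x y) ->
        (forall x y, psi x y) \/ (forall x y, psi x y <-> th x y)].

Definition semisimple : Prop :=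
  forall x y : T, (forall th, is_maximal_cong th -> th x y) -> x = y.

Definition catf m n (a : 'I_m -> T) (b : 'I_n -> T) : 'I_(m + n) -> T :=
  fun i => match split i with inl j => a j | inr j => b j end.

Definition centralizes (alpha beta delta : T -> T -> Prop) : Prop :=
  forall (m n : nat) (t : ('I_(m + n) -> T) -> T), is_term t ->
  forall (a a' : 'I_m -> T) (b b' : 'I_n -> T),
    (forall i, alpha (a i) (a' i)) -> (forall j, beta (b j) (b' j)) ->
    delta (t (catf a b)) (t (catf a b')) ->
    delta (t (catf a' b)) (t (catf a' b')).

Definition commutator (alpha beta : T -> T -> Prop) (x y : T) : Prop :=
  forall delta, is_cong delta -> centralizes alpha beta delta -> delta x y.

Fixpoint derived (k : nat) : T -> T -> Prop :=
  if k is k'.+1 then commutator (derived k') (derived k') else total_rel.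

Definition solvable : Prop :=
  exists k, forall x y : T, derived k x y <-> x = y.

Definition abelian : Prop :=
  forall x y : T, commutator total_rel total_rel x y <-> x = y.

Definition affine : Prop := abelian /\ has_maltsev_term.

Inductive gen (n : nat) (G : {set {ffun 'I_n -> T}}) : {ffun 'I_n -> T} -> Prop :=
| gen_base g : g \in G -> gen G g
| gen_op (s : sym A) (a : 'I_(arity s) -> {ffun 'I_n -> T}) :
    (forall j, gen G (a j)) -> gen G [ffun c => op (fun j => a j c)].

Definition generates n (G : {set {ffun 'I_n -> T}}) : Prop :=
  forall x, gen G x.

Definition generatesb n (G : {set {ffun 'I_n -> T}}) : bool :=
  if excluded_middle_informative (generates G) then true else false.

Definition dA (n : nat) : nat :=
  \big[minn/#|[set: {ffun 'I_n -> T}]|]_(G : {set {ffun 'I_n -> T}} | generatesb G) #|G|.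

Definition dA_linear : Prop :=
  exists C N : nat, forall n, N <= n -> dA n <= C * n.

End UA.

(* Main.v *)
Require Import Defs.
From HB Require Import structures.
From mathcomp Require Import all_boot ssralg.
From Stdlib Require Import Classical ClassicalEpsilon FunctionalExtensionality.

(** Tame congruence theory for a maximal congruence [th] of a finite solvable algebra: on a
    minimal set of [th] either every polynomial depends on one variable modulo [th], or the
    minimal set modulo [th] is an abelian group for which all polynomials are sums of
    unary ones.

    Counting: if all powers have generating sets of linear size, then some term [t] in many
    variables is such that values of [t] differing only in "frequent" variables (those whose
    unary slice is shared by many variables) connect all of the algebra.  Otherwise a
    tuple in the n-th power would be determined, up to a choice inside a proper colour
    class at each coordinate, by boundedly many generators, and (|A|-1)^n times a polynomial
    in n is less than |A|^n.

    This [t] excludes the first alternative.  By semisimplicity the coordinates from the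
    second one separate points, and filling the frequent variables shows that the algebra
    is closed under a+b-c.  It is then a faithful semisimple module over the ring S
    generated by the linear parts of the unary polynomials; the right ideal I generated by
    the linear parts of frequent slices satisfies I A = A, hence I W = W for every
    submodule W of a power of A, so I contains 1.  Therefore x-y+z is obtained from [t]. *)

Set Implicit Arguments.
Unset Strict Implicit.
Unset Printing Implicit Defensive.

Import GRing.Theory.

(** * Iterates on finite sets, and changing a tuple one coordinate at a time *)

Definition as_bool (P : Prop) : bool :=
  if excluded_middle_informative P then true else false.

Lemma as_boolP (P : Prop) : reflect P (as_bool P).
Proof.
by rewrite /as_bool; case: excluded_middle_informative => H; constructor.
Qed.

Lemma ex_min_measure (X : Type) (P : X -> Prop) (f : X -> nat) :
  (exists x, P x) -> exists x, P x /\ forall y, P y -> f x <= f y.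
Proof.
case=> x Px; have [n] := ubnP (f x); elim: n => // n IHn in x Px *.
rewrite ltnS => le_fx.
case: (classic (exists y, P y /\ f y < f x)) => [[y [Py lt_yx]]|noy].
  by apply: (IHn y) => //; apply: leq_trans lt_yx le_fx.
exists x; split=> // y Py; rewrite leqNgt; apply/negP => lt_yx.
by apply: noy; exists y.
Qed.

(** The orbit of [x] enters a cycle of length [d] after [i] steps, with [i + d <= #|X|]; [N] is at
    least [i] and a multiple of [d]. *)
Lemma iter_idem (X : finType) (h : X -> X) (N : nat) :
  #|X| <= N -> (forall d, 0 < d <= #|X| -> d %| N) ->
  forall x, iter N h (iter N h x) = iter N h x.
Proof.
move=> leN dvdN x.
have [i [d [d_gt0 [le_id eq_id]]]] : exists i d,
    0 < d /\ i + d <= #|X| /\ iter (i + d) h x = iter i h x.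
  pose F := fun k : 'I_#|X|.+1 => iter k h x.
  have : ~ injective F.
    by move=> /leq_card; rewrite card_ord ltnn.
  move=> ninj; apply: NNPP => none; apply: ninj => i j eqF.
  apply: val_inj => /=; apply/eqP; rewrite eqn_leq.
  have aux (a b : 'I_#|X|.+1) : F a = F b -> a <= b.
    move=> eqab; rewrite leqNgt; apply/negP => lt_ba; apply: none.
    exists b, (a - b); rewrite subn_gt0 subnKC; last exact: ltnW.
    by split=> //; split; [rewrite -ltnS ltn_ord | exact: eqab].
  by rewrite !aux.
have stepd k : i <= k -> iter (k + d) h x = iter k h x.
  by move=> /subnK <-; rewrite -addnA iterD eq_id -iterD.
have stepm m k : i <= k -> iter (k + m * d) h x = iter k h x.
  move=> le_ik; elim: m => [|m IHm]; first by rewrite addn0.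
  by rewrite mulSnr addnA stepd // (leq_trans le_ik) ?leq_addr.
have /dvdnP[m defN] : d %| N.
  by apply: dvdN; rewrite d_gt0 (leq_trans _ le_id) ?leq_addl.
rewrite -iterD {2}defN stepm // (leq_trans _ leN) // (leq_trans _ le_id) //.
exact: leq_addr.
Qed.

Lemma iter_fact_idem (X : finType) (n : nat) (h : X -> X) (x : X) :
  #|X| <= n -> iter n`! h (iter n`! h x) = iter n`! h x.
Proof.
move=> leXn; apply: iter_idem; first exact: leq_trans leXn (fact_geq n).
by move=> d /andP[d0 led]; apply: dvdn_fact; rewrite d0 (leq_trans led).
Qed.

Definition upd (I : finType) (X : Type) (c : I -> X) (i : I) (a : X) : I -> X :=
  fun j => if j == i then a else c j.

Lemma upd_same (I : finType) (X : Type) (c : I -> X) (i : I) : upd c i (c i) = c.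
Proof.
by apply: functional_extensionality => j; rewrite /upd; case: eqP => // ->.
Qed.

Lemma upd_upd (I : finType) (X : Type) (c : I -> X) (i : I) (a b : X) :
  upd (upd c i a) i b = upd c i b.
Proof. by apply: functional_extensionality => k; rewrite /upd; case: eqP. Qed.

Lemma one_at_a_time (I : finType) (X : Type) (D : pred I)
    (S : (I -> X) -> (I -> X) -> Prop) :
  (forall c, S c c) -> (forall b a c, S a b -> S b c -> S a c) ->
  (forall c i a, D i -> S c (upd c i a)) ->
  forall x y, (forall i, ~~ D i -> x i = y i) -> S x y.
Proof.
move=> Srefl Strans Supd x y eqD.
(* The hybrids lead from [x] to [y] as [s] grows to the full enumeration. *)
pose hyb (s : seq I) := fun i => if i \in s then y i else x i.
have Shyb s : S x (hyb s).
  elim: s => [|i s IHs].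
    by have -> : hyb [::] = x by apply: functional_extensionality.
  apply: Strans IHs _.
  have -> : hyb (i :: s) = upd (hyb s) i (y i).
    apply: functional_extensionality => j; rewrite /hyb /upd inE.
    by case: (j =P i) => // ->.
  case Di: (D i); first exact: Supd.
  have -> : y i = hyb s i by rewrite /hyb -eqD ?Di //; case: ifP.
  by rewrite upd_same.
have <- : hyb (enum I) = y; last exact: Shyb.
by apply: functional_extensionality => i; rewrite /hyb mem_enum.
Qed.

(** * Polynomials and congruences *)

Section Polynomials.
Variable A : algebra.
Local Notation T := (carrier A).

Lemma is_poly_comp k l (F : ('I_k -> T) -> T) (g : 'I_k -> ('I_l -> T) -> T) :
  is_poly F -> (forall i, is_poly (g i)) -> is_poly (fun v => F (fun i => g i v)).
Proof.
move=> polyF polyg; elim: polyF => [j|c|s h _ IHh]; first exact: polyg.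
  exact: poly_const.
exact: (@poly_op A l s (fun j v => h j (fun i => g i v))).
Qed.

Definition up (f : T -> T) : Prop := is_poly (fun v : 'I_1 -> T => f (v ord0)).

Definition bp (p : T -> T -> T) : Prop :=
  is_poly (fun v : 'I_2 -> T => p (v ord0) (v ord_max)).

Lemma up_app k (f : T -> T) (F : ('I_k -> T) -> T) :
  up f -> is_poly F -> is_poly (fun v => f (F v)).
Proof. by move=> upf polyF; apply: (is_poly_comp (g := fun=> F) upf). Qed.

Lemma bp_app k (p : T -> T -> T) (F G : ('I_k -> T) -> T) :
  bp p -> is_poly F -> is_poly G -> is_poly (fun v => p (F v) (G v)).
Proof.
move=> bpp polyF polyG.
apply: (is_poly_comp (g := fun i : 'I_2 => if i == ord0 then F else G) bpp).
by move=> i; case: ifP.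
Qed.

Lemma up_id : up id. Proof. exact: poly_proj. Qed.

Lemma up_comp f g : up f -> up g -> up (fun x => f (g x)).
Proof. by move=> upf upg; apply: (up_app upf). Qed.

Lemma up_iter f n : up f -> up (iter n f).
Proof. by move=> upf; elim: n => [|n IHn]; [exact: up_id | exact: up_comp]. Qed.

Lemma is_poly_iterl k (p : T -> T -> T) (F G : ('I_k -> T) -> T) n :
  bp p -> is_poly F -> is_poly G ->
  is_poly (fun v => iter n (fun w => p w (G v)) (F v)).
Proof.
by move=> bpp polyF polyG; elim: n => //= n IHn; apply: bp_app.
Qed.

Lemma is_poly_iterr k (p : T -> T -> T) (F G : ('I_k -> T) -> T) n :
  bp p -> is_poly F -> is_poly G ->
  is_poly (fun v => iter n (p (G v)) (F v)).
Proof.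
by move=> bpp polyF polyG; elim: n => //= n IHn; apply: bp_app.
Qed.

Lemma bp_swap p : bp p -> bp (fun x y => p y x).
Proof.
by move=> bpp; apply: (bp_app (F := fun v => v ord_max) (G := fun v => v ord0) bpp);
  apply: poly_proj.
Qed.

Lemma bp_up p f g h : bp p -> up f -> up g -> up h ->
  bp (fun x y => h (p (f x) (g y))).
Proof.
move=> bpp upf upg uph; apply: (up_app uph); apply: (bp_app bpp).
  by apply: (up_app upf); apply: poly_proj.
by apply: (up_app upg); apply: poly_proj.
Qed.

Lemma bp_upl p y : bp p -> up (p^~ y).
Proof. by move=> bpp; apply: bp_app => //; [exact: poly_proj | exact: poly_const]. Qed.

Lemma bp_upr p x : bp p -> up (p x).
Proof. by move=> /bp_swap bpp; exact: (bp_upl x bpp). Qed.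

Lemma up_upd k (t : ('I_k -> T) -> T) c i : is_poly t -> up (fun x => t (upd c i x)).
Proof.
move=> polyt; apply: (is_poly_comp (g := fun j v => upd c i (v ord0) j) polyt).
by move=> j; rewrite /upd; case: eqP => _; [exact: poly_proj | exact: poly_const].
Qed.

Lemma bp_upd k (t : ('I_k -> T) -> T) c i j :
  is_poly t -> bp (fun x y => t (upd (upd c i x) j y)).
Proof.
move=> polyt.
apply: (is_poly_comp (g := fun l v => upd (upd c i (v ord0)) j (v ord_max) l) polyt).
move=> l; rewrite /upd; case: eqP => _; first exact: poly_proj.
by case: eqP => _; [exact: poly_proj | exact: poly_const].
Qed.

Lemma term_poly k (t : ('I_k -> T) -> T) : is_term t -> is_poly t.
Proof. by elim=> [j|s g _ IHg]; [exact: poly_proj | exact: poly_op]. Qed.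

Lemma is_term_comp k l (F : ('I_k -> T) -> T) (g : 'I_k -> ('I_l -> T) -> T) :
  is_term F -> (forall i, is_term (g i)) -> is_term (fun v => F (fun i => g i v)).
Proof.
move=> termF termg; elim: termF => [j|s h _ IHh]; first exact: termg.
exact: (@term_op A l s (fun j v => h j (fun i => g i v))).
Qed.

Lemma catf_lshift m n (a : 'I_m -> T) (b : 'I_n -> T) i : catf a b (lshift n i) = a i.
Proof. by rewrite /catf (unsplitK (inl i)). Qed.

Lemma catf_rshift m n (a : 'I_m -> T) (b : 'I_n -> T) i : catf a b (rshift m i) = b i.
Proof. by rewrite /catf (unsplitK (inr i)). Qed.

(** All elements of the algebra are passed as parameters, so one parameter list serves every
    subpolynomial in the induction. *)
Lemma poly_term k (F : ('I_k -> T) -> T) : is_poly F ->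
  exists t : ('I_(k + #|T|) -> T) -> T,
    is_term t /\ forall x, F x = t (catf x (fun i => enum_val i)).
Proof.
elim=> [j|c|s g _ IHg].
- exists (fun v => v (lshift _ j)); split; first exact: term_proj.
  by move=> x; rewrite catf_lshift.
- exists (fun v => v (rshift _ (enum_rank c))); split; first exact: term_proj.
  by move=> x; rewrite catf_rshift enum_rankK.
- have [t Ht] := fin_all_exists IHg.
  exists (fun v => op (fun j => t j v)); split; first by apply: term_op => j; case: (Ht j).
  by move=> x; congr op; apply: functional_extensionality => j; case: (Ht j).
Qed.

Section Congruence.
Variables (r : T -> T -> Prop) (congr_r : is_cong r).

Lemma cong_refl x : r x x. Proof. by case: congr_r. Qed.
Lemma cong_sym x y : r x y -> r y x. Proof. by case: congr_r => _ + _ _; apply. Qed.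
Lemma cong_trans y x z : r x y -> r y z -> r x z.
Proof. by case: congr_r => _ _ + _; apply. Qed.

Lemma cong_poly k (F : ('I_k -> T) -> T) x y :
  is_poly F -> (forall i, r (x i) (y i)) -> r (F x) (F y).
Proof.
move=> polyF rxy; elim: polyF => [j|c|s g _ IHg] //; first exact: cong_refl.
by case: congr_r => _ _ _; apply.
Qed.

Lemma cong_up f x y : up f -> r x y -> r (f x) (f y).
Proof. by move=> upf rxy; apply: (cong_poly (x := fun=> x) (y := fun=> y) upf). Qed.

Lemma cong_bp p x y x' y' : bp p -> r x x' -> r y y' -> r (p x y) (p x' y').
Proof.
move=> bpp rx ry; apply: (cong_trans (y := p x' y)).
  exact: (cong_up (f := p^~ y) (bp_upl y bpp)).
exact: (cong_up (bp_upr x' bpp)).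
Qed.

End Congruence.

Lemma poly_basic_op (s : sym A) : is_poly (@op A s).
Proof.
by apply: (@poly_op A _ s (fun j v => v j)) => j; apply: poly_proj.
Qed.

Lemma cong_of_up (r : T -> T -> Prop) :
  (forall x, r x x) -> (forall x y, r x y -> r y x) ->
  (forall x y z, r x y -> r y z -> r x z) ->
  (forall f x y, up f -> r x y -> r (f x) (f y)) -> is_cong r.
Proof.
move=> rr rs rt rup; split=> // s a b rab.
(* The first [n] arguments are already replaced; each replacement is a unary polynomial step. *)
suff H n : forall c : 'I_(arity s) -> T,
    (forall j, c j = if j < n then b j else a j) -> r (op a) (op c).
  by apply: (H (arity s)) => j; rewrite ltn_ord.
elim: n => [|n IHn] c defc.
  by have -> : c = a by [apply: functional_extensionality]; apply: rr.
case: (ltnP n (arity s)) => [lt_n|le_n]; last first.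
  apply: IHn => j; rewrite defc.
  by have lt_jn := leq_trans (ltn_ord j) le_n; rewrite lt_jn ltnW.
pose i := Ordinal lt_n; pose c' := upd c i (a i).
apply: (rt _ (op c')).
  apply: IHn => j; rewrite /c' /upd; case: eqP => [->|/eqP neq]; first by rewrite ltnn.
  by rewrite defc ltnS leq_eqVlt -val_eqE /= in neq *; rewrite (negbTE neq).
have <- : upd c i (b i) = c.
  by rewrite -[RHS](upd_same c i) defc ltnSn.
by apply: (rup (fun w => op (upd c i w))) => //; apply: up_upd; apply: poly_basic_op.
Qed.

Lemma derived_refl k x : @derived A k x x.
Proof. by case: k => // k d congd _; apply: cong_refl. Qed.

(** The operation [r] is a semilattice on c and d. From r(c,c) = r(c,d) the term condition yields
    that r(d,c) = c and r(d,d) = d are related, so the pair (c,d) survives in every derived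
    congruence. *)
Lemma solvable_no_snag (r : T -> T -> T) c d :
  solvable A -> bp r -> r d d = d -> r c d = c -> r d c = c -> r c c = c -> c = d.
Proof.
move=> [k solk] /poly_term[t [termt deft]] rdd rcd rdc rcc; apply/solk.
have E x y : r x y =
    t (catf (fun i : 'I_2 => if i == ord0 then x else y) (fun i => enum_val i)).
  by rewrite -deft.
elim: k {solk} => // k IHk dl congd cent.
(* Regroups the variables: the first argument of [r] is one block, the second argument with the
   parameters is the other. *)
pose g (i : 'I_(2 + #|T|)) : ('I_(1 + (1 + #|T|)) -> T) -> T := fun v =>
  match split i with
  | inl j => if j == ord0 then v (lshift _ ord0) else v (rshift _ (lshift _ ord0))
  | inr j => v (rshift _ (rshift _ j))
  end.
have termg : is_term (fun v => t (fun i => g i v)).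
  apply: is_term_comp => // i; rewrite /g; case: (split i) => j.
    by case: eqP => _; apply: term_proj.
  exact: term_proj.
pose cst (y : T) : 'I_(1 + #|T|) -> T := catf (fun _ : 'I_1 => y) (fun i => enum_val i).
have E' x y : t (fun i => g i (catf (fun _ : 'I_1 => x) (cst y))) = r x y.
  rewrite E; congr t; apply: functional_extensionality => i.
  rewrite /g [in RHS]/catf; case: (split i) => j.
    by case: eqP => _; rewrite ?catf_lshift // /cst catf_rshift catf_lshift.
  by rewrite /cst !catf_rshift.
have := cent _ _ _ termg (fun=> c) (fun=> d) (cst c) (cst d).
rewrite !E' rcc rcd rdc rdd; apply; last exact: cong_refl.
  by move=> _; exact: IHk.
move=> j; rewrite /cst /catf; case: (split j) => i; last exact: derived_refl.
exact: IHk.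
Qed.

End Polynomials.

(** * Minimal sets *)

Lemma iter_fact_id (X : finType) (U : X -> Prop) (h : X -> X) (u : X) :
  (forall x, U x -> U (h x)) ->
  (forall x y, U x -> U y -> h x = h y -> x = y) ->
  U u -> iter #|X|`! h u = u.
Proof.
move=> Uh hinj Uu; have Uit n v : U v -> U (iter n h v) by move=> Uv; elim: n => //= n; apply: Uh.
have itinj n v w : U v -> U w -> iter n h v = iter n h w -> v = w.
  move=> Uv Uw; elim: n => //= n IHn /hinj eqh; apply: IHn; apply: eqh; exact: Uit.
by apply: (itinj #|X|`!) => //; [exact: Uit | exact: iter_fact_idem].
Qed.

(** Where the n-th iterate is the identity, the iterate [n.-1] is a polynomial inverse of [h]; this
    is how permutations are inverted below. *)
Lemma iter_predK (X : Type) (h : X -> X) (n : nat) (u : X) : 0 < n ->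
  h (iter n.-1 h u) = iter n h u /\ iter n.-1 h (h u) = iter n h u.
Proof. by case: n => // n _; rewrite -iterSr. Qed.

Section MinimalSet.
Variables (A : algebra) (th : carrier A -> carrier A -> Prop).
Local Notation T := (carrier A).
Hypothesis max_th : is_maximal_cong th.

Let congth : is_cong th. Proof. by case: max_th. Qed.

(** The condition on x and y defines a congruence above [th]. It is not total because [f] does not
    collapse, so maximality makes it [th]. *)
Lemma maximal_cong_sep (f : T -> T) : up f -> (exists x y, ~ th (f x) (f y)) ->
  forall x y, (forall g, up g -> th (f (g x)) (f (g y))) -> th x y.
Proof.
move=> upf [x0 [y0 nfxy]]; pose r x y := forall g, up g -> th (f (g x)) (f (g y)).
have congr_r : is_cong r.
  apply: cong_of_up => [x g _|x y rxy g upg|x y z rxy ryz g upg|h x y uph rxy g upg].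
  - exact: (cong_refl congth).
  - by apply: (cong_sym congth); apply: rxy.
  - by exact: (cong_trans congth (rxy g upg) (ryz g upg)).
  - by apply: (rxy (fun w => g (h w))); apply: up_comp.
case: max_th => _ _ /(_ r congr_r)[x y thxy g upg|tot|eqr x y].
- by do 2!apply: (cong_up congth) => //.
- by case: nfxy; apply: (tot x0 y0 id); apply: up_id.
- by move/eqr.
Qed.

(** The fixed points of [e] form a minimal set of [th], called the trace below. Minimality enters in
    the form used later: a polynomial that preserves the set is either constant on it modulo [th] or
    injective on it. *)
Definition minimal_idem (e : T -> T) : Prop :=
  [/\ up e, (forall x, e (e x) = e x), (exists x y, ~ th (e x) (e y)) &
      forall f, up f -> (forall x, e x = x -> e (f x) = f x) ->
        (exists x y, [/\ e x = x, e y = y & ~ th (f x) (f y)]) ->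
      forall x y, e x = x -> e y = y -> f x = f y -> x = y].

Lemma minimal_idem_exists : exists e, minimal_idem e.
Proof.
(* Among the noncollapsing unary polynomials, take one with the smallest image. *)
pose P f := up f /\ exists x y, ~ th (f x) (f y).
have [f [[upf ncf] minf]] : exists f, P f /\
    forall g, P g -> #|[set f x | x : T]| <= #|[set g x | x : T]|.
  apply: (@ex_min_measure _ P (fun f => #|[set f x | x : T]|)).
  exists id; split; first exact: up_id.
  by case: max_th.
have inj_im h : up h ->
    (exists x y, ~ th (h (f x)) (h (f y))) ->
    forall x y, h (f x) = h (f y) -> f x = f y.
  move=> uph nch.
  have eqim : h @: [set f x | x : T] = [set h (f x) | x : T] by rewrite -imset_comp.
  have /imset_injP injh : #|h @: [set f x | x : T]| == #|[set f x | x : T]|.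
    rewrite eqn_leq leq_imset_card eqim minf //.
    by split=> //; apply: up_comp.
  by move=> x y eqh; apply: injh => //; apply: imset_f.
have [g [upg ncg]] : exists g, up g /\ exists x y, ~ th (f (g (f x))) (f (g (f y))).
  apply: NNPP => none; case: (ncf) => x [y]; apply.
  apply: (maximal_cong_sep upf ncf) => h uph.
  by apply: NNPP => nth; apply: none; exists h; split=> //; exists x, y.
pose h x := f (g x).
have injh x y : h (f x) = h (f y) -> f x = f y.
  by apply: inj_im => //; apply: up_comp.
pose U x := exists y, x = f y.
have Uh x : U (h x) by exists (g x).
(* [h] maps into the range of [f] and is injective there, so this iterate is the identity on that
   range. *)
pose e := iter #|T|`! h.
have Ue x : U (e x) by rewrite /e; have [<- _] := iter_predK h x (fact_gt0 #|T|); apply: Uh.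
have eU x : U x -> e x = x.
  by apply: iter_fact_id => // _ _ [a ->] [b ->]; apply: injh.
have Ufix x : e x = x -> U x by move=> <-.
exists e; split.
- by apply: up_iter; apply: up_comp.
- by move=> x; apply: eU.
- by case: ncf => x [y nth]; exists (f x), (f y); rewrite !eU //; [exists y | exists x].
- move=> k upk _ [x0 [y0 [/Ufix[a ->] /Ufix[b ->] nk]]] _ _ /Ufix[x ->] /Ufix[y ->].
  by apply: inj_im => //; exists a, b.
Qed.

End MinimalSet.

(** * The twin lemma: collapsing the trace does not depend on parameters *)

Section Twin.
Variables (A : algebra) (th : carrier A -> carrier A -> Prop) (e : carrier A -> carrier A).
Local Notation T := (carrier A).
Hypotheses (max_th : is_maximal_cong th) (min_e : minimal_idem th e).
Local Notation U := (fun x => e x = x).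

Let congth : is_cong th. Proof. by case: max_th. Qed.

Definition collapses (f : T -> T) := forall x y, U x -> U y -> th (f x) (f y).

Lemma injective_on_trace f : up f -> (forall x, U x -> U (f x)) -> ~ collapses f ->
  forall x y, U x -> U y -> f x = f y -> x = y.
Proof.
move=> upf Uf ncf x y; case: min_e => _ _ _ inj_e; apply: (inj_e f) => //.
apply: NNPP => none; apply: ncf => {}x {}y Ux Uy.
by apply: NNPP => nth; apply: none; exists x, y.
Qed.

Lemma iter_trace f n x : (forall x, U x -> U (f x)) -> U x -> U (iter n f x).
Proof. by move=> Uf Ux; elim: n => //= n; apply: Uf. Qed.

Lemma trace_noncollapse : ~ collapses id.
Proof.
by case: min_e => _ idem [x [y nth]] _ cid; apply: nth; apply: cid.
Qed.

(** The pairs that all unary polynomials send into [S] form a congruence containing [th] and all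
    pairs from the trace. As [th] does not contain the latter, this congruence is total. *)
Lemma trace_connected (S : T -> T -> Prop) :
  (forall x y, th x y -> S x y) -> (forall x y, S x y -> S y x) ->
  (forall x y z, S x y -> S y z -> S x z) ->
  (forall h u v, up h -> U u -> U v -> S (h u) (h v)) -> forall x y, S x y.
Proof.
move=> Sth Ssym Strans Sh x y.
pose r x y := forall f, up f -> S (f x) (f y).
have congr_r : is_cong r.
  apply: cong_of_up => [a g _|a b rab g upg|a b c rab rbc g upg|h a b uph rab g upg].
  - by apply: Sth; apply: cong_refl.
  - by apply: Ssym; apply: rab.
  - by apply: Strans (rab g upg) (rbc g upg).
  - by apply: (rab (fun w => g (h w))); apply: up_comp.
case: max_th => _ _ /(_ r congr_r)[a b thab g upg|tot|eqr].
- by apply: Sth; apply: (cong_up congth).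
- by apply: (tot x y id); apply: up_id.
- case: trace_noncollapse => a b Ua Ub; apply/eqr => f upf; exact: Sh.
Qed.

Hypothesis solvA : solvable A.

(* A polynomial that is a permutation of the trace for one value of the parameter and
   collapses it for another yields a semilattice operation on a two-element set. *)
Lemma twin_trace (p : T -> T -> T) (a b : T) : bp p -> (forall x y, U (p x y)) ->
  U a -> U b -> collapses (p^~ b) -> collapses (p^~ a).
Proof.
move=> bpp Up Ua Ub colb; apply: NNPP => ncola.
set N := #|T|`!; have N0 : 0 < N := fact_gt0 _.
(* Now [p1 x a = x] on the trace, each [p1^~ y] is idempotent, and [p1^~ b] sends the trace into the
   class of [c]. *)
pose p1 x y := iter N (p^~ y) x.
have bp1 : bp p1 by apply: is_poly_iterl => //; apply: poly_proj.
have Up1 x y : U (p1 x y).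
  by rewrite /p1; have [<- _] := iter_predK (p^~ y) x N0.
have p1a x : U x -> p1 x a = x.
  apply: (iter_fact_id (U := U)) => //.
  by apply: (injective_on_trace (f := p^~ a)) => //; apply: bp_upl.
have p1K x y : p1 (p1 x y) y = p1 x y by apply: iter_fact_idem.
have col1 x y : U x -> U y -> th (p1 x b) (p1 y b).
  move=> Ux Uy; rewrite /p1 -(iter_predK (p^~ b) x N0).1 -(iter_predK (p^~ b) y N0).1.
  by apply: colb; apply: iter_trace.
pose c := p1 a b; have Uc : U c by apply: Up1.
have [d [Ud ncd]] : exists d, U d /\ ~ th d c.
  apply: NNPP => none; apply: trace_noncollapse => x y Ux Uy.
  apply: (@cong_trans _ _ congth c); last apply: (cong_sym congth).
    by apply: NNPP => nth; apply: none; exists x.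
  by apply: NNPP => nth; apply: none; exists y.
(* [h a = d] while [h b] lies in the class of [c], so [h] does not collapse and hence permutes the
   trace. *)
pose h y := p1 d y; have uph : up h by apply: bp_upr.
have hinj x y : U x -> U y -> h x = h y -> x = y.
  apply: (injective_on_trace (f := h)) => // [x' _|col]; first exact: Up1.
  apply: ncd; apply: (@cong_trans _ _ congth (h b)).
    by rewrite -{1}(p1a d Ud); apply: col.
  exact: col1.
have hN x : U x -> iter N h x = x by apply: (iter_fact_id (U := U)) => // y _; apply: Up1.
(* Inverting [h] in the second argument makes [d] a two-sided unit on the trace, and [c] absorbing
   on the right modulo [th]. *)
pose q x z := p1 x (iter N.-1 h z).
have bpq : bp q.
  apply: (@bp_up _ p1 id (iter N.-1 h) id) => //.
  - exact: up_id.
  - exact: up_iter.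
  - exact: up_id.
have Uq x z : U (q x z) by apply: Up1.
have ha : h a = d by apply: p1a.
have qxd x : U x -> q x d = x.
  by move=> Ux; rewrite /q -ha (iter_predK h a N0).2 hN // p1a.
have qdz z : U z -> q d z = z.
  by move=> Uz; rewrite /q -/(h _) (iter_predK h z N0).1 hN.
have qhb x : q x (h b) = p1 x b by rewrite /q (iter_predK h b N0).2 hN.
have thz : th (h b) c by apply: col1.
have qxc x : U x -> th (q x c) c.
  move=> Ux; apply: (@cong_trans _ _ congth (q x (h b))).
    by apply: (cong_up congth (bp_upr x bpq)); apply: (cong_sym congth).
  by rewrite qhb; apply: col1.
(* Iteration in the second argument makes each [q1 x] idempotent, at the cost of [q1 x d = x]; the
   permutation [pi] measures this defect. *)
pose q1 x z := iter N (q x) z.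
have bpq1 : bp q1 by apply: is_poly_iterr => //; apply: poly_proj.
have q1dz z : U z -> q1 d z = z.
  by move=> Uz; rewrite /q1; elim: (N) => //= n ->; apply: qdz.
have q1K x z : q1 x (q1 x z) = q1 x z by apply: iter_fact_idem.
pose pi x := q1 x d.
have uppi : up pi by apply: bp_upl.
have Upi x : U (pi x).
  by rewrite /pi /q1; have [<- _] := iter_predK (q x) d N0.
have pid : pi d = d by apply: q1dz.
have pic : th (pi c) c.
  rewrite /pi /q1 -(iter_predK (q c) d N0).2 qxd //.
  elim: (N.-1) => [|n IHn] /=; first exact: (cong_refl congth).
  apply: (@cong_trans _ _ congth (q c c)); last exact: qxc.
  exact: (cong_up congth (bp_upr c bpq)).
have piN x : U x -> iter N pi x = x.
  apply: (iter_fact_id (U := U)) => // {}x y; apply: (injective_on_trace (f := pi)) => // col.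
  apply: ncd; apply: (@cong_trans _ _ congth (pi c)) => //.
  by rewrite -{1}pid; apply: col.
(* Undoing [pi] restores the unit [d]. Moreover [x] is now a value of the idempotent map [r x], so
   [r x x = x], and c, d form a snag. *)
pose r x y := q1 (iter N.-1 pi x) y.
have bpr : bp r.
  apply: (@bp_up _ q1 (iter N.-1 pi) id id) => //.
  - exact: up_iter.
  - exact: up_id.
  - exact: up_id.
have rxd x : U x -> r x d = x.
  by move=> Ux; rewrite /r -/(pi _) (iter_predK pi x N0).1 piN.
have rdy y : U y -> r d y = y.
  move=> Uy; rewrite /r; suff -> : iter N.-1 pi d = d by apply: q1dz.
  by elim: (N.-1) => //= n ->.
have rxx x : U x -> r x x = x.
  move=> Ux; rewrite /r -{2}(piN x Ux) -(iter_predK pi x N0).1 q1K.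
  by rewrite -/(pi _) (iter_predK pi x N0).1 piN.
apply: ncd; rewrite (@solvable_no_snag _ r c d) //; first exact: (cong_refl congth).
all: by rewrite ?rxd ?rdy ?rxx.
Qed.

(** Parameters outside the trace are reached by [trace_connected]: [th]-steps do not affect
    collapsing, and polynomial images of trace pairs fall under [twin_trace]. *)
Lemma twin_param (p : T -> T -> T) (a b : T) : bp p -> (forall x y, U (p x y)) ->
  collapses (p^~ b) -> collapses (p^~ a).
Proof.
move=> bpp Up.
pose S a b := collapses (p^~ a) <-> collapses (p^~ b).
suff: S a b by case.
have colth x y : th x y -> collapses (p^~ x) -> collapses (p^~ y).
  move=> thxy col u v Uu Uv.
  apply: (@cong_trans _ _ congth (p u x)).
    by apply: (cong_up congth (bp_upr u bpp)); apply: (cong_sym congth).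
  apply: (@cong_trans _ _ congth (p v x)); first exact: col.
  exact: (cong_up congth (bp_upr v bpp)).
apply: trace_connected => [x y thxy|x y [Sxy Syx]|x y z [Sxy Syx] [Syz Szy]|h u v uph Uu Uv].
- by split; apply: colth => //; apply: (cong_sym congth).
- by split.
- by split=> ?; [apply: Syz; apply: Sxy | apply: Syx; apply: Szy].
- have bph : bp (fun x y => p x (h y)).
    by apply: (@bp_up _ p id h id) => //; apply: up_id.
  by split; apply: (twin_trace bph).
Qed.

(** The same for constancy on the whole algebra, with [trace_connected] applied to the first
    variable. *)
Lemma twin_full (p : T -> T -> T) (a b : T) : bp p -> (forall x y, U (p x y)) ->
  (forall x y, th (p x b) (p y b)) -> forall x y, th (p x a) (p y a).
Proof.
move=> bpp Up cst; apply: (trace_connected (S := fun x y => th (p x a) (p y a))).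
- by move=> x y thxy; apply: (cong_up congth (bp_upl a bpp)).
- by move=> x y; apply: (cong_sym congth).
- by move=> x y z; apply: (cong_trans congth).
- move=> h u v uph Uu Uv.
  have bph : bp (fun x y => p (h x) y).
    by apply: (@bp_up _ p h id id) => //; apply: up_id.
  apply: (@twin_param (fun x y => p (h x) y) a b bph _ _ u v Uu Uv).
    by move=> x y; apply: Up.
  move=> x y _ _.
  exact: cst.
Qed.

End Twin.

(** * Growth *)

(** Bernoulli's inequality for (1 + 1/a)^a, cleared of denominators. *)
Lemma expnS_self_ge a : 0 < a -> 2 * a ^ a <= a.+1 ^ a.
Proof.
move=> a0; suff H k : a ^ k * (a + k) <= a.+1 ^ k * a.
  by have := H a; rewrite addnn -mul2n mulnCA mulnA leq_pmul2r.
elim: k => [|k IHk]; first by rewrite !expn0 !mul1n addn0.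
rewrite !expnS -!mulnA; apply: leq_trans (leq_mul (leqnn a.+1) IHk).
rewrite mulnCA [leqRHS]mulnCA leq_mul2l; apply/orP; right.
by rewrite addnS mulnS mulSn leq_add2r leq_addr.
Qed.

Lemma exp2_beats_poly K C D N0 : exists l, N0 <= l /\ K * (C * l).+1 ^ D < 2 ^ l.
Proof.
pose a := K + C.+1 * D; pose u := a + 2 * D + N0.
have lt_u : u < 2 ^ u by apply: ltn_expl.
pose s := 2 * u; have le_s : a + s * D <= 2 ^ s.
  rewrite /s mulSn mul1n expnD; apply: leq_trans (leq_mul lt_u lt_u).
  rewrite mulSn mulnS addnA leq_add //.
    by rewrite (leq_trans _ (leq_addl _ _)) // /u -addnA leq_addr.
  by rewrite addnn -mul2n mulnAC mulnC leq_mul2l /u addnAC leq_addl orbT.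
exists (2 ^ s); split.
  apply: leq_trans (ltnW (ltn_expl s _)) => //.
  by rewrite /s mul2n -addnn (leq_trans _ (leq_addl _ _)) // /u leq_addl.
have lt_K : K < 2 ^ K by apply: ltn_expl.
have le_C : (C * 2 ^ s).+1 <= 2 ^ (C.+1 + s).
  rewrite expnD; apply: leq_trans (leq_mul (ltnW (ltn_expl C.+1 _)) (leqnn _)) => //.
  by rewrite mulSn -add1n leq_add2r expn_gt0.
have : K * (C * 2 ^ s).+1 ^ D < 2 ^ K * (2 ^ (C.+1 + s)) ^ D.
  apply: leq_trans (_ : K.+1 * (C * 2 ^ s).+1 ^ D <= _).
    by rewrite ltn_pmul2r // expn_gt0.
  by apply: leq_mul => //; case: (D) => [|n] //; rewrite leq_exp2r.
rewrite -expnM -expnD => /leq_trans; apply; rewrite leq_exp2l //.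
by rewrite mulnDl addnA.
Qed.

Lemma exp_ratio_beats_poly K C D N0 r :
  exists n, N0 <= n /\ K * (C * n).+1 ^ D * r.+1 ^ n < r.+2 ^ n.
Proof.
have [l [le_l lt_l]] := exp2_beats_poly K (C * r.+1) D N0.
(* Each block of r+1 coordinates gains a factor 2 by [expnS_self_ge]. *)
exists (r.+1 * l); split; first by rewrite (leq_trans le_l) // leq_pmull.
rewrite mulnA; apply: leq_trans (_ : 2 ^ l * r.+1 ^ (r.+1 * l) <= _).
  by rewrite ltn_pmul2r // expn_gt0.
rewrite !expnM -expnMn; case: (l) => // m; rewrite leq_exp2r //.
exact: expnS_self_ge.
Qed.

Section Growth.
Variable A : algebra.
Local Notation T := (carrier A).

Lemma gen_term n (G : {set {ffun 'I_n -> T}}) g : gen G g ->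
  exists t : ('I_#|G| -> T) -> T,
    is_term t /\ forall c, g c = t (fun i => (enum_val i : {ffun 'I_n -> T}) c).
Proof.
elim=> {g} [g Gg|s a _ IHa].
  exists (fun v => v (enum_rank_in Gg g)); split; first exact: term_proj.
  by move=> c; rewrite enum_rankK_in.
have [t Ht] := fin_all_exists IHa.
exists (fun v => op (fun j => t j v)); split; first by apply: term_op => j; case: (Ht j).
by move=> c; rewrite ffunE; congr op; apply: functional_extensionality => j; case: (Ht j).
Qed.

Lemma dA_generators n : exists2 G : {set {ffun 'I_n -> T}}, generates G & #|G| <= dA A n.
Proof.
rewrite /dA; elim/big_rec: _ => [|G x genG [H genH leH]].
  by exists setT => // x; apply: gen_base; rewrite inE.
rewrite /minn; case: ifP => _; last by exists H.
by exists G => //; apply/as_boolP.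
Qed.

Variable z : T.

Definition slice m (t : ('I_m -> T) -> T) (i : 'I_m) : {ffun T -> T} :=
  [ffun x => t (upd (fun=> z) i x)].

Definition frequent N m (t : ('I_m -> T) -> T) (h : {ffun T -> T}) : bool :=
  N <= #|[pred j | slice t j == h]|.

Lemma card_infrequent N m (t : ('I_m -> T) -> T) :
  #|[pred i | ~~ frequent N t (slice t i)]| <= N * #|{: {ffun T -> T}}|.
Proof.
rewrite -sum1_card (partition_big (slice t) xpredT) //= mulnC -sum_nat_const.
apply: leq_sum => h _; rewrite sum1_card.
case: (boolP (frequent N t h)) => [fh|nfh].
  rewrite eq_card0 // => i; rewrite !inE /=.
  by apply/negbTE/negP => /andP[/negP nf /eqP eqh]; apply: nf; rewrite eqh.
apply: leq_trans (_ : #|[pred j | slice t j == h]| <= N).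
  by apply: subset_leq_card; apply/subsetP => i; rewrite !inE => /andP[].
by rewrite leqNgt; apply/negP => /ltnW; apply/negP.
Qed.

(* Otherwise every tuple is determined by a two-colouring of [T], boundedly many members
   of the generating set, and a choice inside the colour class at every coordinate; there
   are too few such codes. *)
Lemma linear_growth_term N : dA_linear A -> 1 < #|T| ->
  exists m (t : ('I_m -> T) -> T), is_term t /\
    forall chi : T -> bool,
      (forall x y, (forall i, ~~ frequent N t (slice t i) -> x i = y i) ->
         chi (t x) = chi (t y)) ->
      forall a b, chi a = chi b.
Proof.
move=> [C [N0 linC]] T1; apply: NNPP => none.
have [r cardT] : exists r, #|T| = r.+2 by case: #|T| T1 => [|[|r]] // _; exists r.
pose B := N * #|{: {ffun T -> T}}|.
(* [B] bounds the number of infrequent variables; [K] counts the parts [chi] and [psi] of a code,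
   which do not depend on [n]. *)
pose K := #|{: {ffun T -> bool}}| * #|{: {ffun {ffun 'I_B.+1 -> T} -> bool}}|.
have [n [leN0n]] := exp_ratio_beats_poly K C B.+1 N0 r.
rewrite ltnNge => /negP; apply.
have [G genG leG] := dA_generators n.
have ltG : #|G| < (C * n).+1 by rewrite ltnS (leq_trans leG) ?linC.
pose code := ({ffun T -> bool} * {ffun {ffun 'I_B.+1 -> T} -> bool} *
  {ffun 'I_B.+1 -> 'I_(C * n).+1} * {ffun 'I_n -> 'I_r.+1})%type.
pose gens (s : {ffun 'I_B.+1 -> 'I_(C * n).+1}) (c : 'I_n) : {ffun 'I_B.+1 -> T} :=
  [ffun k => nth [ffun=> z] (enum G) (s k) c].
pose cls (chi : {ffun T -> bool}) b := enum [pred a | chi a == b].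
pose decode (u : code) : {ffun 'I_n -> T} :=
  let: (chi, psi, s, w) := u in [ffun c => nth z (cls chi (psi (gens s c))) (w c)].
have onto v : exists u, v = decode u.
  have [t [termt deft]] := gen_term (genG v).
  (* The term producing [v] from the generators violates the claim, which yields a nonconstant
     colouring blind to its frequent variables. *)
  have [chi [resp [a [b neq_ab]]]] : exists chi : {ffun T -> bool},
      (forall x y, (forall i, ~~ frequent N t (slice t i) -> x i = y i) ->
         chi (t x) = chi (t y)) /\ exists a b, chi a <> chi b.
    apply: NNPP => nochi; apply: none; exists #|G|, t; split=> // chi resp a b.
    apply: NNPP => neq; apply: nochi; exists (finfun chi); split.
      by move=> x y /resp; rewrite !ffunE.
    by exists a, b; rewrite !ffunE.
  pose I := enum [pred i | ~~ frequent N t (slice t i)].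
  have sizeI : size I <= B by rewrite -cardE card_infrequent.
  (* Positions of the infrequent generators, padded with 0; the successor in ['I_B.+1] makes the
     index type inhabited for [inord]. *)
  pose s : {ffun 'I_B.+1 -> 'I_(C * n).+1} := [ffun k : 'I_B.+1 => inord (nth 0 (map val I) k)].
  pose fill (f : {ffun 'I_B.+1 -> T}) (i : 'I_#|G|) :=
    if i \in I then f (inord (index i I)) else z.
  pose psi := [ffun f => chi (t (fill f))].
  pose w : {ffun 'I_n -> 'I_r.+1} := [ffun c => inord (index (v c) (cls chi (chi (v c))))].
  exists (chi, psi, s, w); apply/ffunP => c; rewrite !ffunE.
  have -> : chi (t (fill (gens s c))) = chi (v c).
    rewrite deft; apply: resp => i nfi.
    have iI : i \in I by rewrite mem_enum.
    have idx : (inord (index i I) : 'I_B.+1) = index i I :> nat.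
      by rewrite inordK // ltnS; apply: leq_trans sizeI; rewrite ltnW // index_mem.
    rewrite /fill iI !ffunE idx (nth_map i) ?index_mem // nth_index //= inordK; last first.
      exact: ltn_trans (ltn_ord i) ltG.
    by rewrite (enum_val_nth [ffun=> z]).
  have vcls : v c \in cls chi (chi (v c)) by rewrite mem_enum inE.
  rewrite inordK ?nth_index //; move: vcls; rewrite -index_mem => vcls.
  apply: leq_trans vcls _; rewrite -cardE.
  (* Both colours occur, so a colour class has at most r+1 of the r+2 elements. *)
  have [a0 neq] : exists a0, chi a0 != chi (v c).
    case: (chi a =P chi (v c)) => [eqa|/eqP]; last by exists a.
    by exists b; rewrite -eqa; apply/eqP => /esym.
  have -> : r.+1 = #|predC1 a0| by rewrite cardC1 cardT.
  apply: subset_leq_card; apply/subsetP => x; rewrite !inE => /eqP eqx.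
  by apply/eqP => eqx0; move: neq; rewrite -eqx0 eqx eqxx.
have : #|{: {ffun 'I_n -> T}}| <= #|{: code}|.
  rewrite -cardsT; apply: leq_trans (leq_imset_card decode {: code}).
  apply: subset_leq_card; apply/subsetP => v _; have [u ->] := onto v.
  exact: imset_f.
by rewrite /K !card_prod !card_ffun !card_ord cardT card_bool.
Qed.

End Growth.

Local Open Scope ring_scope.

(** * Coordinates in abelian groups *)

Lemma zmod_exponent (V : zmodType) (X : finType) (enc : V -> X) (n : nat) :
  injective enc -> (#|X| <= n)%N -> forall v : V, v *+ n`! = 0.
Proof.
move=> enc_inj leXn v.
pose F (k : 'I_#|X|.+1) := enc (v *+ k).
suff [d [d0 [led dv0]]] : exists d, (0 < d)%N /\ (d <= n)%N /\ v *+ d = 0.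
  have /dvdnP[m ->] : (d %| n`!)%N by apply: dvdn_fact; rewrite d0.
  by rewrite mulnC mulrnA dv0 mul0rn.
have ninj : ~ injective F by move=> /leq_card; rewrite card_ord ltnn.
apply: NNPP => none; apply: ninj => i j /enc_inj eqF.
have aux (a b : 'I_#|X|.+1) : v *+ a = v *+ b -> (a <= b)%N.
  move=> eqab; rewrite leqNgt; apply/negP => lt_ba; apply: none.
  exists (a - b)%N; rewrite subn_gt0; split=> //; split.
    by rewrite (leq_trans (leq_subr _ _)) // (leq_trans _ leXn) // -ltnS.
  by rewrite mulrnBr ?eqab ?subrr // ltnW.
by apply: val_inj => /=; apply/eqP; rewrite eqn_leq !aux.
Qed.

Section GroupModulo.
Variables (T : finType) (th : T -> T -> Prop) (e : T -> T).
Hypotheses (thr : forall x, th x x) (ths : forall x y, th x y -> th y x).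
Hypothesis tht : forall x y z, th x y -> th y z -> th x z.
Hypotheses (eK : forall x, e (e x) = e x) (the : forall x y, th x y -> th (e x) (e y)).
Variables (add : T -> T -> T) (zero : T).
Hypotheses (eadd : forall x y, e (add x y) = add x y) (ezero : e zero = zero).
Hypothesis thadd : forall x y x' y', th x x' -> th y y' -> th (add x y) (add x' y').
Hypothesis addA : forall x y z, e x = x -> e y = y -> e z = z ->
  th (add x (add y z)) (add (add x y) z).
Hypothesis addC : forall x y, e x = x -> e y = y -> th (add x y) (add y x).
Hypothesis add0 : forall x, e x = x -> th (add zero x) x.
Hypothesis addN : forall x, e x = x -> exists2 y, e y = y & th (add y x) zero.

Lemma group_modulo : exists (V : zmodType) (phi : T -> V),
  [/\ forall x y, e x = x -> e y = y -> phi (add x y) = phi x + phi y,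
      forall x y, phi (e x) = phi (e y) <-> th (e x) (e y) &
      forall v : V, v *+ #|T|`! = 0].
Proof.
pose rep x := choose (fun y => as_bool (th x y)) x.
have th_rep x : th x (rep x).
  by apply/as_boolP; apply: (@chooseP _ (fun y => as_bool (th x y))); apply/as_boolP.
have rep_eq x y : th x y -> rep x = rep y.
  move=> thxy; rewrite /rep.
  have eqP : (fun z => as_bool (th x z)) =1 (fun z => as_bool (th y z)).
    move=> z; apply/as_boolP/as_boolP => thz; first by apply: tht thz; apply: ths.
    exact: tht thz.
  rewrite (eq_choose eqP); apply: choose_id; apply/as_boolP => //.
  exact: ths.
(* Canonical representatives of the classes that meet the range of [e]; the quotient group lives on
   the subtype of fixed points of [rho]. *)
pose rho x := e (rep (e x)).
have erho x : e (rho x) = rho x by apply: eK.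
have th_rho x : th (rho x) (e x).
  by rewrite -[e x in X in th _ X]eK; apply: the; apply: ths.
have rho_eq x y : th (e x) (e y) -> rho x = rho y.
  by move=> thxy; congr e; apply: rep_eq.
have rhoK x : rho (rho x) == rho x.
  by apply/eqP; apply: rho_eq; rewrite erho; apply: th_rho.
pose X := {x : T | rho x == x}.
pose phi x : X := exist _ (rho x) (rhoK x).
have phiP x y : phi x = phi y <-> th (e x) (e y).
  split=> [[eqr]|/rho_eq eqr]; last exact: val_inj.
  by apply: tht (th_rho y); rewrite -eqr; apply: ths.
have phi_val (u : X) : phi (val u) = u by apply: val_inj => /=; apply/eqP; exact: (valP u).
have eval (u : X) : e (val u) = val u by rewrite -(eqP (valP u)) erho.
pose plus (u v : X) : X := phi (add (val u) (val v)).
have plusE x y : e x = x -> e y = y -> plus (phi x) (phi y) = phi (add x y).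
  move=> ex ey; apply/phiP; rewrite !eadd; apply: thadd => /=.
    by rewrite -{2}ex; apply: th_rho.
  by rewrite -{2}ey; apply: th_rho.
have surj (u : X) : exists2 x, e x = x & u = phi x by exists (val u).
have plusA : associative plus.
  move=> u v w; have [[x ex ->] [y ey ->] [z ez ->]] := And3 (surj u) (surj v) (surj w).
  by rewrite !plusE //; apply/phiP; rewrite !eadd; apply: addA.
have plusC : commutative plus.
  move=> u v; have [[x ex ->] [y ey ->]] := conj (surj u) (surj v).
  by rewrite !plusE //; apply/phiP; rewrite !eadd; apply: addC.
have plus0 : left_id (phi zero) plus.
  move=> u; have [x ex ->] := surj u.
  by rewrite !plusE //; apply/phiP; rewrite eadd ex; apply: add0.
have negP (u : X) : exists v, plus v u = phi zero.
  have [x ex ->] := surj u; have [y ey thy] := addN ex.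
  by exists (phi y); rewrite plusE //; apply/phiP; rewrite eadd ezero.
pose neg u := proj1_sig (constructive_indefinite_description _ (negP u)).
have plusN : left_inverse (phi zero) neg plus.
  by move=> u; rewrite /neg; case: constructive_indefinite_description.
pose V : zmodType := HB.pack X (GRing.isZmodule.Build X plusA plusC plus0 plusN).
exists V, (phi : T -> V); split.
- by move=> x y ex ey; rewrite -plusE.
- by move=> x y; split=> [/phiP|thxy]; rewrite ?eK //; apply/phiP; rewrite !eK.
- exact: (@zmod_exponent V T (val : V -> T) #|T| val_inj).
Qed.

End GroupModulo.

Section Coordinates.
Variable A : algebra.
Local Notation T := (carrier A).

(** Seen through [f], a binary polynomial is a sum of two unary functions: its increments in y do
    not depend on x. The bounded exponent allows multiplicities to be reduced and negatives to be
    written as multiples. *)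
Definition coord (V : zmodType) (f : T -> V) : Prop :=
  (forall p, bp p -> forall x x' y y',
     f (p x y) - f (p x y') = f (p x' y) - f (p x' y'))
  /\ (forall v : V, v *+ #|T|`! = 0).

Lemma coord_up (V : zmodType) (f : T -> V) r : coord f -> up r -> coord (f \o r).
Proof.
move=> [par expo] upr; split=> // p bpp x x' y y' /=.
apply: (par (fun x y => r (p x y))).
by apply: (@bp_up _ p id id r) => //; apply: up_id.
Qed.

End Coordinates.

(** * The abelian group on a minimal set that is not essentially unary *)

Section TypeTwo.
Variables (A : algebra) (th : carrier A -> carrier A -> Prop) (e : carrier A -> carrier A).
Local Notation T := (carrier A).
Hypotheses (max_th : is_maximal_cong th) (min_e : minimal_idem th e).
Hypothesis solvA : solvable A.
Local Notation U := (fun x => e x = x).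

Let congth : is_cong th. Proof. by case: max_th. Qed.

(* Type 1 in the sense of tame congruence theory. *)
Definition essentially_unary : Prop :=
  forall p, bp p -> (forall x y, U (p x y)) ->
    (forall x x' y, th (p x y) (p x' y)) \/ (forall x y y', th (p x y) (p x y')).

Lemma depends_on_trace f : up f -> (exists x x', ~ th (f x) (f x')) ->
  exists h, up h /\ ~ collapses th e (fun u => f (h u)).
Proof.
move=> upf [x [x' nth]]; apply: NNPP => none; apply: nth.
apply: (trace_connected max_th min_e (S := fun x y => th (f x) (f y))).
- by move=> a b thab; apply: (cong_up congth upf).
- by move=> a b; apply: (cong_sym congth).
- by move=> a b c; apply: (cong_trans congth).
- move=> h u v uph Uu Uv; apply: NNPP => nth; apply: none; exists h; split=> // col.
  by apply: nth; apply: col.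
Qed.

(** Take a polynomial depending on both variables, move each dependence onto the trace by
    [depends_on_trace], and make it uniform in the parameter by [twin_param]. *)
Lemma trace_binary : ~ essentially_unary -> exists p,
  [/\ bp p, forall x y, U (p x y), forall y, U y -> ~ collapses th e (p^~ y) &
      forall x, U x -> ~ collapses th e (p x)].
Proof.
move=> nunary.
have [p [bpp Up [x [x' [y nx]]] [x1 [y1 [y1' ny]]]]] : exists p, [/\ bp p,
    forall x y, U (p x y), exists x x' y, ~ th (p x y) (p x' y) &
    exists x y y', ~ th (p x y) (p x y')].
  apply: NNPP => none; apply: nunary => p bpp Up.
  case: (classic (forall x x' y, th (p x y) (p x' y))) => [|nx]; [by left | right].
  move=> x y y'; apply: NNPP => ny; apply: none; exists p; split=> //; last by exists x, y, y'.
  apply: NNPP => none; apply: nx => a a' b; apply: NNPP => nx; apply: none.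
  by exists a, a', b.
have [h [uph nch]] : exists h, up h /\ ~ collapses th e (fun u => p (h u) y).
  by apply: (depends_on_trace (bp_upl y bpp)); exists x, x'.
have [k [upk nck]] : exists k, up k /\ ~ collapses th e (fun u => p x1 (k u)).
  by apply: (depends_on_trace (bp_upr x1 bpp)); exists y1, y1'.
have up1 := @up_id A.
exists (fun u v => p (h u) (k v)); split=> [|u v|v _ col|u _ col].
- exact: (@bp_up _ p h k id).
- exact: Up.
- apply: nch; apply: (@twin_param _ _ _ max_th min_e solvA (fun u y => p (h u) y) y (k v)) => //.
  exact: (@bp_up _ p h id id).
- apply: nck; apply: (@twin_param _ _ _ max_th min_e solvA (fun v x => p x (k v)) x1 (h u)) => //.
  by apply: bp_swap; apply: (@bp_up _ p id k id).
Qed.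

Lemma trace_loop : ~ essentially_unary -> exists add sub zero, [/\ bp add, bp sub,
  [/\ U zero, forall x y, U (add x y) & forall x y, U x -> U (sub x y)],
  [/\ forall x, U x -> add x zero = x & forall x, U x -> add zero x = x] &
  forall x y, U x -> U y -> add (sub x y) y = x /\ sub (add x y) y = x].
Proof.
move=> /trace_binary[p [bpp Up ncl ncr]].
have [a Ua] : exists a, U a.
  by case: (min_e) => _ eK [x _] _; exists (e x).
set N := #|T|`!; have N0 : (0 < N)%N := fact_gt0 _.
pose R x := p x a; pose L x := p a x.
have upR : up R by apply: bp_upl.
have upL : up L by apply: bp_upr.
have RN x : U x -> iter N R x = x.
  apply: (iter_fact_id (U := U)) => [{}x _|]; first exact: Up.
  apply: (injective_on_trace min_e (f := R)) => // [{}x _|]; first exact: Up.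
  exact: ncl.
have LN x : U x -> iter N L x = x.
  apply: (iter_fact_id (U := U)) => [{}x _|]; first exact: Up.
  apply: (injective_on_trace min_e (f := L)) => // [{}x _|]; first exact: Up.
  exact: ncr.
(* The translations by [a] permute the trace; dividing them out makes [p a a] a neutral element, as
   for a principal isotope of a quasigroup. *)
pose add x y := p (iter N.-1 R x) (iter N.-1 L y).
have bpadd : bp add.
  apply: (@bp_up _ p (iter N.-1 R) (iter N.-1 L) id) => //.
  - exact: up_iter.
  - exact: up_iter.
  - exact: up_id.
pose zero := p a a; have Uzero : U zero := Up _ _.
have Uadd x y : U (add x y) := Up _ _.
have add0r x : U x -> add x zero = x.
  move=> Ux; rewrite /add /zero -/(L a) (iter_predK L a N0).2 LN //.
  by rewrite -/(R _) (iter_predK R x N0).1 RN.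
have add0l x : U x -> add zero x = x.
  move=> Ux; rewrite /add /zero -/(R a) (iter_predK R a N0).2 RN //.
  by rewrite -/(L _) (iter_predK L x N0).1 LN.
pose sub x y := iter N.-1 (add^~ y) x.
have bpsub : bp sub by apply: is_poly_iterl => //; apply: poly_proj.
have Usub x y : U x -> U (sub x y) by move=> Ux; apply: (iter_trace _ (f := add^~ y)).
have addN x y : U x -> iter N (add^~ y) x = x.
  apply: (iter_fact_id (U := U)) => [{}x _|]; first exact: Uadd.
  apply: (injective_on_trace min_e (f := add^~ y)) => // [|col]; first exact: bp_upl.
  apply: (trace_noncollapse min_e) => u v Uu Uv.
  rewrite -[id u]add0r // -[id v]add0r //.
  exact: (@twin_param _ _ _ max_th min_e solvA add zero y).
exists add, sub, zero; split=> // x y Ux Uy.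
by rewrite /sub (iter_predK (add^~ y) x N0).1 (iter_predK (add^~ y) x N0).2 addN.
Qed.

(* By [twin_param], an identity that holds when a variable is [zero] holds modulo [th] for
   all values of that variable; this makes the loop an abelian group modulo [th]. *)
Lemma trace_group : ~ essentially_unary -> exists (V : zmodType) (phi : T -> V) sub,
  [/\ bp sub, forall x y, U x -> U (sub x y),
      forall x y, U x -> U y -> phi (sub x y) = phi x - phi y,
      forall x y, phi (e x) = phi (e y) <-> th (e x) (e y) &
      forall v : V, v *+ #|T|`! = 0].
Proof.
move=> /trace_loop[add [sub [zero [bpadd bpsub [Uzero Uadd Usub] [add0r add0l] addK]]]].
have eK : forall x, e (e x) = e x by case: (min_e).
have upe : up e by case: (min_e).
have thr := cong_refl congth; have ths := @cong_sym _ _ congth.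
have tht := fun x y => @cong_trans _ _ congth y x.
have subxx x : U x -> sub x x = zero.
  by move=> Ux; rewrite -{1}(add0l x) //; case: (addK zero x).
have sub_eq x y : U x -> U y -> th (sub x y) zero -> th x y.
  move=> Ux Uy th0; have [<- _] := addK x y Ux Uy; rewrite -[y in X in th _ X]add0l //.
  by apply: (cong_bp congth bpadd).
(* [G] is applied to the difference of the two sides of an identity that holds trivially when one
   variable is [zero]. *)
have const_at_zero (G : T -> T -> T) : bp G -> (forall x y, U (G x y)) ->
    (forall x, U x -> G x zero = zero) -> forall x y, U x -> th (G x y) (G zero y).
  move=> bpG UG G0 x y Ux.
  apply: (@twin_param _ _ _ max_th min_e solvA G y zero) => // u v Uu Uv.
  by rewrite !G0.
have addC x y : U x -> U y -> th (add x y) (add y x).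
  move=> Ux Uy; apply: sub_eq => //.
  have -> : zero = sub (add zero y) (add y zero) by rewrite add0l // add0r // subxx.
  apply: (const_at_zero (fun x y => sub (add x y) (add y x))) => // [|a b|a Ua].
  - by apply: (bp_app bpsub) => //; exact: (bp_swap bpadd).
  - exact: Usub.
  - by rewrite add0r // add0l // subxx.
have addA x y z : U x -> U y -> U z -> th (add x (add y z)) (add (add x y) z).
  move=> Ux Uy Uz; apply: ths; apply: sub_eq => //.
  have -> : zero = sub (add (add zero y) z) (add zero (add y z)).
    by rewrite !add0l // subxx.
  apply: (const_at_zero (fun x z => sub (add (add x y) z) (add x (add y z)))) => // [|a b|a Ua].
  - apply: (bp_app bpsub).
      by apply: (@bp_up _ add (add^~ y) id id) => //; [exact: bp_upl | exact: up_id | exact: up_id].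
    by apply: (@bp_up _ add id (add y) id) => //; [exact: up_id | exact: bp_upr | exact: up_id].
  - exact: Usub.
  - by rewrite !add0r // subxx.
have thadd x y x' y' : th x x' -> th y y' -> th (add x y) (add x' y').
  exact: (cong_bp congth bpadd).
have add0 x : U x -> th (add zero x) x by move=> /add0l ->.
have addN x : U x -> exists2 y, U y & th (add y x) zero.
  by move=> Ux; exists (sub zero x); [exact: Usub | case: (addK zero x Uzero Ux) => ->].
have the x y : th x y -> th (e x) (e y) by apply: (cong_up congth upe).
have [V [phi [phiD phiP expo]]] :=
  group_modulo thr ths tht eK the Uadd Uzero thadd addA addC add0 addN.
exists V, phi, sub; split=> // x y Ux Uy.
by apply/eqP; rewrite eq_sym subr_eq -phiD ?(addK x y _ _).1 //; apply: Usub.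
Qed.

Lemma type_two_coord : ~ essentially_unary -> exists (V : zmodType) (f : T -> V),
  coord f /\ forall x y, th x y <-> forall r, up r -> f (r x) = f (r y).
Proof.
move=> /trace_group[V [phi [sub [bpsub Usub phiB phiP expo]]]].
have eK : forall x, e (e x) = e x by case: (min_e).
have upe : up e by case: (min_e).
have nce : exists x y, ~ th (e x) (e y) by case: (min_e).
exists V, (phi \o e); split; last first.
  move=> x y; split=> [thxy r upr|eqf].
    by apply/phiP; apply: (cong_up congth upe); apply: (cong_up congth upr).
  by apply: (maximal_cong_sep max_th upe nce) => g upg; apply/phiP; apply: eqf.
split=> // p bpp x x' y y' /=.
rewrite -!phiB // -(Usub (e (p x y))) // -(Usub (e (p x' y))) //; apply/phiP.
rewrite !Usub //.
(* The increment from [w] to [y] is zero for [w = y], hence constant in x modulo [th] there, and so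
   also for [w = y']. *)
apply: (@twin_full _ _ _ max_th min_e solvA
  (fun x w => sub (e (p x y)) (e (p x w))) y' y) => [|a b|a b].
- apply: (bp_app bpsub); last by apply: (@bp_up _ p id id e) => //; apply: up_id.
  by apply: up_app => //; apply: (up_app (bp_upl y bpp)); apply: poly_proj.
- exact: Usub.
- have Ue x1 y1 : sub (e x1) (e y1) = e (sub (e x1) (e y1)) by rewrite Usub.
  by rewrite Ue [sub (e (p b y)) _]Ue; apply/phiP; rewrite -!Ue !phiB // !subrr.
Qed.

End TypeTwo.

(** * Sums over lists, with multiplicities reduced modulo an exponent *)

Lemma sumr_flatten_nseq (V : zmodType) (Y : Type) (g : Y -> V) (l : seq Y) n :
  \sum_(s <- flatten (nseq n l)) g s = (\sum_(s <- l) g s) *+ n.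
Proof.
by elim: n => [|n IHn] /=; rewrite ?big_nil ?mulr0n // big_cat IHn mulrS.
Qed.

Lemma sumr_count (V : zmodType) (Y : finType) (g : Y -> V) (l : seq Y) :
  \sum_(s <- l) g s = \sum_s g s *+ count_mem s l.
Proof.
elim: l => [|a l IHl]; first by rewrite big_nil big1.
rewrite big_cons IHl [RHS](eq_bigr (fun s => g s *+ (a == s) + g s *+ count_mem s l)).
  rewrite big_split /=; congr (_ + _).
  rewrite (bigD1 a) //= eqxx mulr1n big1 ?addr0 // => i.
  by rewrite eq_sym => /negbTE ->.
by move=> s _; rewrite /= mulrnDr.
Qed.

Definition reduce (Y : finType) (E : nat) (l : seq Y) : seq Y :=
  flatten [seq nseq (count_mem s l %% E) s | s <- enum Y].

Lemma mem_reduce (Y : finType) E (l : seq Y) s : s \in reduce E l -> s \in l.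
Proof.
case/flattenP => _ /mapP[u _ ->] /nseqP[-> ]; rewrite -has_pred1 has_count.
by move/leq_trans; apply; apply: leq_mod.
Qed.

Lemma size_reduce (Y : finType) E (l : seq Y) :
  (0 < E)%N -> (size (reduce E l) <= #|Y| * E)%N.
Proof.
move=> E0; rewrite /reduce size_flatten /shape -map_comp cardE.
elim: (enum Y) => //= s e IHe; rewrite size_nseq mulSn leq_add //.
by rewrite ltnW // ltn_mod.
Qed.

Lemma sum_reduce (V : zmodType) (Y : finType) E (g : Y -> V) (l : seq Y) :
  (forall v : V, v *+ E = 0) -> \sum_(s <- reduce E l) g s = \sum_(s <- l) g s.
Proof.
move=> expo; rewrite /reduce big_flatten big_map big_enum /= [RHS]sumr_count.
apply: eq_bigr => s _; rewrite [in RHS](divn_eq (count_mem s l) E) mulrnDr mulnC.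
rewrite mulrnA expo mul0rn add0r; elim: (_ %% E)%N => [|n IHn] /=.
  by rewrite big_nil.
by rewrite big_cons IHn mulrS.
Qed.

(** The entries of [l] go to the first indices of [r]; the surplus indices receive the default [y0],
    which contributes nothing. *)
Lemma sum_assign (V : zmodType) (I : eqType) (Y : Type) (g : Y -> V) (y0 : Y)
    (r : seq I) (l : seq Y) :
  uniq r -> (size l <= size r)%N -> g y0 = 0 ->
  \sum_(i <- r) g (nth y0 l (index i r)) = \sum_(s <- l) g s.
Proof.
move=> + + gy0; elim: r l => [|i r IHr] [|s l] //=.
- by rewrite !big_nil.
- by move=> _ _; rewrite big_nil big1 // => j _; rewrite nth_nil.
move=> /andP[nir ur] szl; rewrite !big_cons eqxx /= -(IHr l) //; congr (_ + _).
by apply: eq_big_seq => j jr; case: eqP => // eqij; rewrite eqij jr in nir.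
Qed.

(** * Polynomials as sums of their slices in a coordinate *)

Section CoordinateSums.
Variable A : algebra.
Local Notation T := (carrier A).

Lemma coord_context (V : zmodType) (f : T -> V) m (t : ('I_m -> T) -> T) c c' i a b :
  coord f -> is_poly t ->
  f (t (upd c i a)) - f (t (upd c i b)) = f (t (upd c' i a)) - f (t (upd c' i b)).
Proof.
move=> [par _] polyt.
pose S c c' := f (t (upd c i a)) - f (t (upd c i b)) = f (t (upd c' i a)) - f (t (upd c' i b)).
apply: (@one_at_a_time _ _ xpredT S) => // [d2 d1 d3|d j y _]; first exact: etrans.
rewrite /S; case: (eqVneq j i) => [->|neq]; first by rewrite !upd_upd.
rewrite -{1 2}(upd_same d j).
exact: (par (fun x y => t (upd (upd d j x) i y)) (bp_upd d j i polyt)).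
Qed.

Variable z : T.
Local Notation zs := (fun=> z).

Lemma slice0 m (t : ('I_m -> T) -> T) i : slice z t i z = t zs.
Proof. by rewrite ffunE; congr t; exact: (upd_same zs i). Qed.

Lemma up_slice m (t : ('I_m -> T) -> T) i : is_poly t -> up (slice z t i).
Proof.
move=> polyt; rewrite /up.
have -> : (fun v : 'I_1 -> T => slice z t i (v ord0)) = fun v => t (upd zs i (v ord0)).
  by apply: functional_extensionality => v; rewrite ffunE.
exact: (up_upd zs i polyt).
Qed.

(** Switching the variables from [z] to [x] one by one gives a telescoping sum, and [coord_context]
    evaluates each increment at the constant tuple. *)
Lemma coord_sum (V : zmodType) (f : T -> V) m (t : ('I_m -> T) -> T) x :
  coord f -> is_poly t ->
  f (t x) - f (t zs) = \sum_i (f (slice z t i (x i)) - f (t zs)).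
Proof.
move=> cf polyt; pose c (s : seq 'I_m) := fun j => if j \in s then x j else z.
have cE (s : seq 'I_m) : uniq s ->
    f (t (c s)) - f (t zs) = \sum_(i <- s) (f (slice z t i (x i)) - f (t zs)).
  elim: s => [|i s IHs] /=; first by rewrite big_nil subrr.
  case/andP=> nis us; rewrite big_cons -(IHs us).
  have -> : c (i :: s) = upd (c s) i (x i).
    apply: functional_extensionality => j; rewrite /c /upd inE.
    by case: (j =P i) => // ->.
  have updz : upd (c s) i z = c s by rewrite -[RHS](upd_same _ i) /c (negbTE nis).
  have := coord_context (c s) zs i (x i) z cf polyt.
  by rewrite updz [upd zs i z](upd_same zs i) ffunE => <-; rewrite addrA subrK.
have := cE (enum 'I_m) (enum_uniq _); rewrite big_enum /= => <-; congr (f (t _) - _).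
by apply: functional_extensionality => j; rewrite /c mem_enum.
Qed.

(** By [coord_sum] a term is a function of one block plus a function of the other, so the term
    condition for equality holds by cancellation. *)
Lemma coord_abelian (V : zmodType) (f : T -> V) : coord f -> injective f -> abelian A.
Proof.
move=> cf injf x y; split=> [com|-> d congd _]; last exact: (cong_refl congd).
apply: com => [|m n t /term_poly polyt a a' b b' _ _ eqt].
  by apply: cong_of_up => // [a1 b1 c1 -> | g a1 b1 _ ->].
have E c d : f (t (catf c d)) = f (t zs) +
    (\sum_(i < m) (f (slice z t (lshift n i) (c i)) - f (t zs)) +
     \sum_(j < n) (f (slice z t (rshift m j) (d j)) - f (t zs))).
  apply/eqP; rewrite addrC -subr_eq (coord_sum _ cf polyt) big_split_ord /=; apply/eqP.
  by congr (_ + _); apply: eq_bigr => i _; rewrite ?catf_lshift ?catf_rshift.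
apply: injf; rewrite !E; do 2!congr (_ + _).
by move/(congr1 f): eqt; rewrite !E => /addrI/addrI.
Qed.

End CoordinateSums.

(** * Filling the frequent variables *)

Section Realization.
Variable A : algebra.
Local Notation T := (carrier A).
Local Notation Om := (T * T * T)%type.
Local Notation Y := {ffun Om -> T}.

Definition poly3 (s : Om -> T) : Prop :=
  is_poly (fun v : 'I_3 -> T =>
    s (v ord0, v (@Ordinal 3 1 isT), v (@Ordinal 3 2 isT))).

Lemma poly3_const c : poly3 [ffun=> c].
Proof.
rewrite /poly3; set F := (F in is_poly F).
have -> : F = fun=> c by apply: functional_extensionality => v; rewrite /F ffunE.
exact: poly_const.
Qed.

Lemma poly3_up r (s : Om -> T) : up r -> poly3 s -> poly3 [ffun x => r (s x)].
Proof.
move=> upr polys; rewrite /poly3; set F := (F in is_poly F).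
have -> : F = fun v => r (s (v ord0, v (@Ordinal 3 1 isT), v (@Ordinal 3 2 isT))).
  by apply: functional_extensionality => v; rewrite /F ffunE.
exact: (up_app upr polys).
Qed.

Variables (z : T) (m : nat) (t : ('I_m -> T) -> T).
Hypothesis polyt : is_poly t.
Let E := #|T|`!.
Let bound := (#|{: Y}| * E)%N.
Local Notation freq := (frequent z bound t).
Local Notation t0 := (t (fun=> z)).

(** A formal sum of compositions h(s(x)), stored as a list of inner functions [s] for each outer
    function [h]. *)
Definition bag := {ffun T -> T} -> seq Y.

Definition admissible (l : bag) : Prop :=
  forall h s, s \in l h -> poly3 s /\ freq h.

Definition bag_sum (V : zmodType) (f : T -> V) (l : bag) (x : Om) : V :=
  \sum_h \sum_(s <- l h) (f (h (s x)) - f (h z)).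

(* The variables sharing a frequent slice are numerous enough to receive the entries of
   the corresponding list, once multiplicities are reduced modulo the exponent. *)
Lemma bag_realized (l : bag) : admissible l -> exists2 M : Y, poly3 M &
  forall (V : zmodType) (f : T -> V), coord f ->
    forall x, f (M x) = f t0 + bag_sum f l x.
Proof.
move=> adm; pose cls h := enum [pred j | slice z t j == h].
pose sg j : Y := nth [ffun=> z] (reduce E (l (slice z t j))) (index j (cls (slice z t j))).
have polysg j : poly3 (sg j).
  have [le|lt] := leqP (size (reduce E (l (slice z t j)))) (index j (cls (slice z t j))).
    by rewrite /sg nth_default //; apply: poly3_const.
  by have /mem_reduce/adm[] := mem_nth [ffun=> z] lt.
exists [ffun x => t (fun j => sg j x)].
  rewrite /poly3; set F := (F in is_poly F).
  have -> : F = fun v => t (fun j => sg j (v ord0, v (@Ordinal 3 1 isT), v (@Ordinal 3 2 isT))).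
    by apply: functional_extensionality => v; rewrite /F ffunE.
  apply: (is_poly_comp
    (g := fun j v => sg j (v ord0, v (@Ordinal 3 1 isT), v (@Ordinal 3 2 isT))) polyt) => j.
  exact: polysg.
move=> V f cf x; rewrite ffunE; apply/eqP; rewrite addrC -subr_eq; apply/eqP.
rewrite (coord_sum z _ cf polyt) (partition_big (slice z t) xpredT) //=.
apply: eq_bigr => h _.
rewrite -(sum_reduce _ _ (cf.2 : forall v, v *+ E = 0)).
rewrite -(@sum_assign V 'I_m Y (fun s => f (h (s x)) - f (h z)) [ffun=> z] (cls h)).
- rewrite big_enum /=; apply: eq_bigr => j /eqP eqh.
  by rewrite /sg eqh -eqh (slice0 z).
- exact: enum_uniq.
- case lh: (l h) => [|s l'].
    case eqr: (reduce _ _) => [|s r] //.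
    by have := @mem_reduce _ E [::] s; rewrite eqr mem_head => /(_ isT).
  have [_] : poly3 s /\ freq h by apply: adm; rewrite lh mem_head.
  by rewrite /frequent -cardE; apply: leq_trans; apply: size_reduce; apply: fact_gt0.
- by rewrite ffunE subrr.
Qed.

Definition bag_cat (l1 l2 : bag) : bag := fun h => l1 h ++ l2 h.
(** Modulo the exponent [E], repeating [E.-1] times is negation. *)
Definition bag_opp (l : bag) : bag := fun h => flatten (nseq E.-1 (l h)).
Definition bag_one (h : {ffun T -> T}) (s : Y) : bag :=
  fun h' => if h' == h then [:: s] else [::].

Lemma admissible_cat l1 l2 : admissible l1 -> admissible l2 -> admissible (bag_cat l1 l2).
Proof. by move=> adm1 adm2 h s; rewrite mem_cat => /orP[/adm1|/adm2]. Qed.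

Lemma admissible_opp l : admissible l -> admissible (bag_opp l).
Proof. by move=> adm h s /flattenP[_ /nseqP[-> _] /adm]. Qed.

Lemma admissible_one h (s : Y) : freq h -> poly3 s -> admissible (bag_one h s).
Proof.
by move=> fh ps h' s'; rewrite /bag_one; case: eqP => // ->; rewrite inE => /eqP ->.
Qed.

Lemma bag_sum_nil (V : zmodType) (f : T -> V) x : bag_sum f (fun=> [::]) x = 0.
Proof. by rewrite /bag_sum big1 // => h _; rewrite big_nil. Qed.

Lemma bag_sum_cat (V : zmodType) (f : T -> V) l1 l2 x :
  bag_sum f (bag_cat l1 l2) x = bag_sum f l1 x + bag_sum f l2 x.
Proof. by rewrite -big_split; apply: eq_bigr => h _; rewrite big_cat. Qed.

Lemma bag_sum_opp (V : zmodType) (f : T -> V) l x :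
  coord f -> bag_sum f (bag_opp l) x = - bag_sum f l x.
Proof.
move=> [_ expo]; rewrite -sumrN; apply: eq_bigr => h _; rewrite sumr_flatten_nseq.
by apply/eqP; rewrite -addr_eq0 -mulrSr prednK ?fact_gt0 // expo.
Qed.

Lemma bag_sum_one (V : zmodType) (f : T -> V) h s x :
  bag_sum f (bag_one h s) x = f (h (s x)) - f (h z).
Proof.
rewrite /bag_sum (bigD1 h) //= /bag_one eqxx big_seq1 big1 ?addr0 // => h' neq.
by rewrite (negbTE neq) big_nil.
Qed.

(** The order of quantifiers matters: one bag must serve all coordinates simultaneously. *)
Definition reachable (a : T) : Prop := exists2 l : bag, admissible l &
  forall (V : zmodType) (f : T -> V), coord f -> forall x, f a = f t0 + bag_sum f l x.

Hypothesis rich : forall chi : T -> bool,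
  (forall x y, (forall i, ~~ freq (slice z t i) -> x i = y i) -> chi (t x) = chi (t y)) ->
  forall a b, chi a = chi b.

(** Changing a frequent variable adds the difference of two one-term bags, so reachability is a
    colouring to which [rich] applies; the empty bag reaches [t0]. *)
Lemma all_reachable a : reachable a.
Proof.
have r0 : reachable t0.
  by exists (fun=> [::]) => // V f _ x; rewrite bag_sum_nil addr0.
suff /(rich (chi := fun a => as_bool (reachable a)))/(_ a t0) :
    forall x y, (forall i, ~~ freq (slice z t i) -> x i = y i) ->
    as_bool (reachable (t x)) = as_bool (reachable (t y)).
  by move/as_boolP: r0 => -> /as_boolP.
have step c i b : freq (slice z t i) -> reachable (t c) -> reachable (t (upd c i b)).
  move=> fi [l adm repr].
  exists (bag_cat l (bag_cat (bag_one (slice z t i) [ffun=> b])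
                             (bag_opp (bag_one (slice z t i) [ffun=> c i])))).
    apply: admissible_cat => //; apply: admissible_cat.
      exact: (admissible_one fi (poly3_const _)).
    by apply: admissible_opp; exact: (admissible_one fi (poly3_const _)).
  move=> V f cf x; rewrite !bag_sum_cat addrA -(repr V f cf) bag_sum_opp // !bag_sum_one.
  have := coord_context c (fun=> z) i b (c i) cf polyt.
  have cancel_z (p q r : V) : (p - q) - (r - q) = p - r by rewrite opprB addrA subrK.
  rewrite cancel_z upd_same !ffunE => <-.
  by rewrite addrC subrK.
apply: (@one_at_a_time _ _ (fun i => freq (slice z t i))
  (fun c c' => as_bool (reachable (t c)) = as_bool (reachable (t c')))) => //.
  by move=> d2 d1 d3 -> .
move=> c i b fi; apply/as_boolP/as_boolP; first exact: step.
by move/(step _ i (c i) fi); rewrite upd_upd upd_same.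
Qed.

Lemma affine_combination a b c : exists d, forall (V : zmodType) (f : T -> V), coord f ->
  f d = f a + f b - f c.
Proof.
have [[la adma repra] [lb admb reprb] [lc admc reprc]] :=
  And3 (all_reachable a) (all_reachable b) (all_reachable c).
have [|M _ reprM] := @bag_realized (bag_cat la (bag_cat lb (bag_opp lc))).
  by do 2!apply: admissible_cat => //; apply: admissible_opp.
exists (M (z, z, z)) => V f cf; rewrite reprM // !bag_sum_cat bag_sum_opp //.
rewrite (repra V f cf (z, z, z)) (reprb V f cf (z, z, z)) (reprc V f cf (z, z, z)).
rewrite -[RHS]addrA opprD [f t0 + bag_sum f lb _ + _]addrACA subrr add0r.
by rewrite -!addrA.
Qed.

Hypothesis separated : forall x y : T,
  (forall (V : zmodType) (f : T -> V), coord f -> f x = f y) -> x = y.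

(** Sum and negative come from [affine_combination] with base point [z]; the group laws hold in
    every coordinate, hence in the algebra by [separated]. *)
Lemma affine_group : exists (Z : zmodType) (i : T -> Z) (j : Z -> T),
  [/\ cancel i j, cancel j i, coord i, i z = 0 &
      forall (V : zmodType) (f : T -> V), coord f ->
        forall u v, f (j (u + v)) = f (j u) + f (j v) - f z].
Proof.
have [add addE] : exists add : T -> T -> T, forall a b (V : zmodType) (f : T -> V),
    coord f -> f (add a b) = f a + f b - f z.
  exists (fun a b => proj1_sig (constructive_indefinite_description _ (affine_combination a b z))).
  by move=> a b; case: constructive_indefinite_description.
have [opp oppE] : exists opp : T -> T, forall a (V : zmodType) (f : T -> V),
    coord f -> f (opp a) = f z + f z - f a.
  exists (fun a => proj1_sig (constructive_indefinite_description _ (affine_combination z z a))).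
  by move=> a; case: constructive_indefinite_description.
have addA : associative add.
  move=> a b c; apply: separated => V f cf; rewrite !addE // !addrA.
  by congr (_ - _); rewrite -!addrA; do 2!congr (_ + _); rewrite addrC.
have addC : commutative add.
  by move=> a b; apply: separated => V f cf; rewrite !addE // [f a + _]addrC.
have add0 : left_id z add.
  by move=> a; apply: separated => V f cf; rewrite addE // addrC addKr.
have addN : left_inverse z opp add.
  by move=> a; apply: separated => V f cf; rewrite addE // oppE // subrK addrK.
pose Z : zmodType := HB.pack T (GRing.isZmodule.Build T addA addC add0 addN).
pose i : T -> Z := id.
have parE (a b c d : T) : (forall (V : zmodType) (f : T -> V), coord f ->
    f a - f b = f c - f d) -> i a - i b = i c - i d.
  move=> H; apply/eqP; rewrite subr_eq addrAC eq_sym subr_eq; apply/eqP.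
  change (add c b = add a d); apply: separated => V f cf; rewrite !addE //.
  by congr (_ - _); have /eqP := H V f cf; rewrite subr_eq addrAC eq_sym subr_eq => /eqP.
exists Z, i, id; split=> //.
  split=> [p bpp x x' y y'|v]; first by apply: parE => V f [+ _]; apply.
  exact: (@zmod_exponent Z T id #|T|).
by move=> V f cf u v; rewrite -addE.
Qed.

End Realization.

(** * The module argument *)

(** Closure under sums alone; finite exponent supplies negatives in [span_opp]. *)
Inductive span (V : zmodType) (P : V -> Prop) : V -> Prop :=
| span0 : span P 0
| spanD u v : P u -> span P v -> span P (u + v).

Section Span.
Variables (V : zmodType) (P : V -> Prop).

Lemma span_gen u : P u -> span P u.
Proof. by move=> Pu; rewrite -[u]addr0; apply: spanD => //; apply: span0. Qed.

Lemma span_add u v : span P u -> span P v -> span P (u + v).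
Proof. by move=> + Pv; elim=> [|w w' Pw _ IHw]; rewrite ?add0r // -addrA; apply: spanD. Qed.

Lemma span_opp n u : (0 < n)%N -> (forall v : V, v *+ n = 0) -> span P u -> span P (- u).
Proof.
move=> n0 expo Pu; have -> : - u = u *+ n.-1.
  by apply/eqP; rewrite eq_sym -addr_eq0 -mulrSr prednK // expo.
by elim: n.-1 => [|k IHk]; rewrite ?mulr0n ?mulrS; [exact: span0 | exact: span_add].
Qed.

End Span.

Lemma span_map (V W : zmodType) (P : V -> Prop) (Q : W -> Prop) (g : V -> W) :
  g 0 = 0 -> (forall u v, g (u + v) = g u + g v) -> (forall u, P u -> span Q (g u)) ->
  forall u, span P u -> span Q (g u).
Proof.
move=> g0 gD gP u; elim=> [|v w Pv _ IHw]; first by rewrite g0; apply: span0.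
by rewrite gD; apply: span_add => //; apply: gP.
Qed.

Section Module.
Variable A : algebra.
Local Notation T := (carrier A).
Local Notation Om := (T * T * T)%type.
Local Notation Y := {ffun Om -> T}.

Variables (z : T) (m : nat) (t : ('I_m -> T) -> T).
Hypothesis polyt : is_poly t.
Let bound := (#|{: Y}| * #|T|`!)%N.
Local Notation freq := (frequent z bound t).
Local Notation t0 := (t (fun=> z)).

Hypothesis reach : forall a, reachable z t a.

Variables (Z : zmodType) (i : T -> Z) (j : Z -> T).
Hypotheses (iK : cancel i j) (jK : cancel j i) (coord_i : coord i) (i0 : i z = 0).
Hypothesis coordD : forall (V : zmodType) (f : T -> V), coord f ->
  forall u v, f (j (u + v)) = f (j u) + f (j v) - f z.

Local Notation L := {ffun Om -> Z}.

Let expoZ : forall v : Z, v *+ #|T|`! = 0. Proof. by case: coord_i. Qed.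
Let expoL (w : L) : w *+ #|T|`! = 0.
Proof. by apply/ffunP => x; rewrite ffunMnE expoZ ffunE. Qed.

Let fact0 : (0 < #|T|`!)%N := fact_gt0 _.

(** For polynomial [r] these maps are the generators of the ring acting on [Z]; the ring itself is
    replaced by spans. *)
Definition linpart (r : T -> T) (v : Z) : Z := i (r (j v)) - i (r z).

Lemma j0 : j 0 = z. Proof. by rewrite -i0 iK. Qed.

Lemma linpart0 r : linpart r 0 = 0.
Proof. by rewrite /linpart j0 subrr. Qed.

Lemma linpartD r : up r -> forall u v, linpart r (u + v) = linpart r u + linpart r v.
Proof.
move=> upr u v; have := coordD (coord_up coord_i upr) u v; rewrite /linpart /= => ->.
by rewrite -addrA addrACA.
Qed.

Lemma linpartN r : up r -> forall u, linpart r (- u) = - linpart r u.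
Proof. by move=> upr u; apply/eqP; rewrite -addr_eq0 -linpartD // addNr linpart0. Qed.

Lemma linpartB r : up r -> forall u v, linpart r (u - v) = linpart r u - linpart r v.
Proof. by move=> upr u v; rewrite linpartD // linpartN. Qed.

Lemma linpart_comp r s v : up r -> linpart r (linpart s v) = linpart (fun x => r (s x)) v.
Proof.
by move=> upr; rewrite {2}/linpart linpartB // /linpart !iK opprB addrA subrK.
Qed.

Lemma linpart_id v : linpart id v = v.
Proof. by rewrite /linpart jK i0 subr0. Qed.

Definition apply_lin (r : T -> T) (w : L) : L := [ffun x => linpart r (w x)].

Lemma apply_lin0 r : apply_lin r 0 = 0.
Proof. by apply/ffunP => x; rewrite !ffunE linpart0. Qed.

Lemma apply_linD r : up r -> forall u v, apply_lin r (u + v) = apply_lin r u + apply_lin r v.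
Proof. by move=> upr u v; apply/ffunP => x; rewrite !ffunE linpartD. Qed.

Definition embed (s : Y) : L := [ffun x => i (s x)].

Definition poly_module : L -> Prop :=
  span (fun w => exists2 s : Y, poly3 s & w = embed s).

(** This is I W, where W is [poly_module] and I is the right ideal from the frequent slices. *)
Definition freq_ideal : L -> Prop :=
  span (fun w => exists (h : {ffun T -> T}) (s : Y),
    [/\ freq h, poly3 s & w = apply_lin h (embed s)]).

Lemma freq_up h : freq h -> up h.
Proof.
move=> fh; have : (0 < #|[pred k | slice z t k == h]|)%N.
  apply: leq_trans fh; rewrite muln_gt0 fact0 andbT.
  by apply/card_gt0P; exists [ffun=> z].
by case/card_gt0P => k /eqP <-; apply: up_slice.
Qed.

Lemma poly_module_embed (s : Y) : poly3 s -> poly_module (embed s).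
Proof. by move=> ps; apply: span_gen; exists s. Qed.

Lemma poly_moduleN w : poly_module w -> poly_module (- w).
Proof. exact: (span_opp fact0 expoL). Qed.

Lemma apply_lin_poly r w : up r -> poly_module w -> poly_module (apply_lin r w).
Proof.
move=> upr; apply: span_map; [exact: apply_lin0 | exact: apply_linD|].
move=> _ [s ps ->].
have -> : apply_lin r (embed s) = embed [ffun x => r (s x)] - embed [ffun=> r z].
  by apply/ffunP => x; rewrite !ffunE /linpart iK.
apply: span_add; first by apply: poly_module_embed; apply: poly3_up.
by apply: poly_moduleN; apply: poly_module_embed; apply: poly3_const.
Qed.

Lemma freq_ideal_poly w : freq_ideal w -> poly_module w.
Proof.
elim=> [|_ v [h [s [fh ps ->]]] _ IHv]; first exact: span0.
apply: span_add => //; apply: apply_lin_poly (poly_module_embed ps); exact: freq_up.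
Qed.

Lemma apply_lin_ideal h w : freq h -> poly_module w -> freq_ideal (apply_lin h w).
Proof.
move=> fh; have uph := freq_up fh.
apply: span_map; [exact: apply_lin0 | exact: apply_linD|].
by move=> _ [s ps ->]; apply: span_gen; exists h, s.
Qed.

(** This is I A = A: reachability writes each difference from [t0] as a sum of frequent linear
    parts, and subtracting the case of [z] removes [t0]. *)
Lemma freq_span (b : Z) :
  span (fun v => exists (h : {ffun T -> T}) (c : Z), freq h /\ v = linpart h c) b.
Proof.
pose P v := exists (h : {ffun T -> T}) (c : Z), freq h /\ v = linpart h c.
have spanT a : span P (i a - i t0).
  have [l adm repr] := reach a; rewrite (repr Z i coord_i (z, z, z)) addrC addKr.
  rewrite /bag_sum; elim/big_ind: _ => [|u v|h _]; [exact: span0 | exact: span_add|].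
  rewrite big_seq; elim/big_ind: _ => [|u v|s sl]; [exact: span0 | exact: span_add|].
  have [_ fh] := adm h s sl; apply: span_gen; exists h, (i (s (z, z, z))).
  by rewrite /linpart iK.
have -> : b = (i (j b) - i t0) - (i z - i t0) by rewrite jK i0 opprB addrA subrK subr0.
apply: span_add; first exact: spanT.
by apply: (span_opp fact0 expoZ); apply: spanT.
Qed.

Section Kernels.
Variable K : finType.
Variable th : K -> T -> T -> Prop.
Hypothesis max_th : forall k, is_maximal_cong (th k).
Hypothesis th_coord : forall k, exists (V : zmodType) (f : T -> V),
  coord f /\ forall x y, th k x y <-> forall r, up r -> f (r x) = f (r y).

Definition kernel k (v : Z) : Prop := th k (j v) z.

Lemma kernelP k : exists (V : zmodType) (f : T -> V), coord f /\
  forall v, kernel k v <-> forall r, up r -> f (r (j v)) = f (r z).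
Proof. by have [V [f [cf thE]]] := th_coord k; exists V, f; split=> // v; apply: thE. Qed.

Lemma kernel0 k : kernel k 0.
Proof. by rewrite /kernel j0; case: (max_th k) => congk _ _; apply: (cong_refl congk). Qed.

Lemma kernelD k u v : kernel k u -> kernel k v -> kernel k (u + v).
Proof.
have [V [f [cf kE]]] := kernelP k; rewrite !kE => ku kv r upr.
have := coordD (coord_up cf upr) u v => /= ->.
by rewrite ku // kv // addrK.
Qed.

Lemma kernelN k v : kernel k v -> kernel k (- v).
Proof.
have [V [f [cf kE]]] := kernelP k; rewrite !kE => kv r upr.
have := coordD (coord_up cf upr) v (- v) => /=.
by rewrite subrr j0 kv // => /eqP; rewrite addrAC subrr add0r => /eqP.
Qed.

Lemma kernel_lin k r v : up r -> kernel k v -> kernel k (linpart r v).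
Proof.
move=> upr kv; have [congk _ _] := max_th k.
have := cong_up congk upr kv; have [V [f [cf thE]]] := th_coord k.
rewrite /kernel !thE => eqf s ups.
have := coordD (coord_up cf ups) (linpart r v) (i (r z)).
rewrite /= {1}/linpart subrK iK iK eqf // => /eqP.
by rewrite addrAC -subr_eq subrr eq_sym subr_eq0 => /eqP.
Qed.

Lemma th_kernel k x y : th k x y <-> kernel k (i x - i y).
Proof.
have [V [f [cf thE]]] := th_coord k; rewrite /kernel !thE.
have E r : up r -> f (r x) - f (r y) = f (r (j (i x - i y))) - f (r z).
  move=> upr; have := coordD (coord_up cf upr) (i x - i y) (i y).
  rewrite /= subrK !iK => ->; by rewrite addrAC addrK.
split=> eqf r upr; have /eqP := E r upr.
  by rewrite eqf // subrr eq_sym subr_eq0 => /eqP.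
by rewrite [X in _ == X - _]eqf // subrr subr_eq0 => /eqP.
Qed.

(* Simplicity makes the submodule generated by a value outside the kernel everything. *)
Lemma simple_generation k (w : L) (x : Om) : ~ kernel k (w x) -> forall a : Z,
  exists2 s, span (fun u => exists2 r, up r & u = apply_lin r w) s & kernel k (a - s x).
Proof.
move=> nk; pose S := span (fun u : L => exists2 r, up r & u = apply_lin r w).
have [congk _ maxk] := max_th k.
pose R a b := exists2 s, S s & kernel k (i a - i b - s x).
have congR : is_cong R.
  apply: cong_of_up => [a|a b [s Ss ks]|a b c [s Ss ks] [s' Ss' ks']|g a b upg [s Ss ks]].
  - by exists 0; [exact: span0 | rewrite ffunE !subrr; apply: kernel0].
  - exists (- s); first exact: (span_opp fact0 expoL).
    have -> : i b - i a - (- s) x = - (i a - i b - s x) by rewrite ffunE opprK !opprB addrC.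
    exact: kernelN.
  - exists (s + s'); first exact: span_add.
    have := kernelD ks ks'; rewrite ffunE opprD addrACA.
    by rewrite [i a - i b + _]addrA subrK.
  - exists (apply_lin g s).
      move: Ss; apply: span_map; [exact: apply_lin0 | exact: apply_linD|].
      move=> _ [r upr ->]; apply: span_gen; exists (fun y => g (r y)); first exact: up_comp.
      by apply/ffunP => y; rewrite !ffunE linpart_comp.
    have E : linpart g (i a) - linpart g (i b) = i (g a) - i (g b).
      by rewrite /linpart !iK opprB addrA subrK.
    by have := kernel_lin upg ks; rewrite ffunE !linpartB // E.
have Rth a b : th k a b -> R a b.
  by move/th_kernel => kab; exists 0; [exact: span0 | rewrite ffunE subr0].
have [tot|eqR] := maxk R congR Rth; last first.
  case: nk; apply/eqR; exists w; last by rewrite jK i0 subr0 subrr; apply: kernel0.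
  apply: span_gen; exists id; first exact: up_id.
  by apply/ffunP => y; rewrite ffunE linpart_id.
move=> a; have [s Ss] := tot (j a) z; rewrite jK i0 subr0 => ks.
by exists s.
Qed.

(** The pairs are treated one at a time. The error left so far vanishes at the earlier pairs, hence
    so does the submodule it generates; corrections taken from that submodule do no harm there. *)
Lemma ideal_approx (l : seq (K * Om)) (w : L) : poly_module w ->
  exists2 u, freq_ideal u & forall p, p \in l -> kernel p.1 ((w - u) p.2).
Proof.
move=> Ww; elim: l => [|[k x] l [u Iu vanu]]; first by exists 0 => //; apply: span0.
have [w' w'E] : exists w', w' = w - u by exists (w - u).
rewrite -w'E in vanu.
have Ww' : poly_module w'.
  by rewrite w'E; apply: span_add => //; apply: poly_moduleN; apply: freq_ideal_poly.
case: (classic (kernel k (w' x))) => [kw|nkw].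
  by exists u => // p; rewrite -w'E inE => /predU1P[->|/vanu].
(* Write [w' x] as a sum of [linpart h c], and replace each [c] by a member of the submodule of [w']
   whose value at [x] agrees with [c] modulo the kernel. *)
have [u' Iu' [vanu' ku']] : exists2 u', freq_ideal u' &
    (forall p, p \in l -> kernel p.1 (u' p.2)) /\ kernel k (w' x - u' x).
  elim: (freq_span (w' x)) => [|_ b [h [c [fh ->]]] _ [v Iv [vanv kv]]].
    exists 0; first exact: span0.
    by split=> [p _|]; rewrite ffunE ?subrr; apply: kernel0.
  have uph := freq_up fh.
  have [s Ss ks] := simple_generation nkw c.
  have Ws : poly_module s.
    elim: Ss => [|_ s' [r upr ->] _]; first exact: span0.
    by apply: span_add; apply: apply_lin_poly.
  have vans p : p \in l -> kernel p.1 (s p.2).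
    move=> pl; elim: Ss => [|_ s' [r upr ->] _ ks']; first by rewrite ffunE; apply: kernel0.
    by rewrite !ffunE; apply: kernelD => //; apply: kernel_lin => //; apply: vanu.
  exists (apply_lin h s + v); first by apply: span_add => //; apply: apply_lin_ideal.
  split=> [p pl|].
    by rewrite !ffunE; apply: kernelD; [apply: kernel_lin => //; apply: vans | apply: vanv].
  rewrite !ffunE opprD addrACA -linpartB //; apply: kernelD => //.
  exact: kernel_lin.
exists (u + u'); first exact: span_add.
have E p : (w - (u + u')) p.2 = w' p.2 - u' p.2 by rewrite opprD addrA -w'E !ffunE.
move=> p; rewrite inE E => /predU1P[->|pl] //.
by apply: kernelD; [apply: vanu | apply: kernelN; apply: vanu'].
Qed.

Hypothesis th_sep : forall x y, (forall k, th k x y) -> x = y.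

Lemma poly_module_ideal w : poly_module w -> freq_ideal w.
Proof.
move=> Ww; have [u Iu ku] := ideal_approx (enum {: K * Om}) Ww.
suff -> : w = u by [].
apply/eqP; rewrite -subr_eq0; apply/eqP/ffunP => x; rewrite [RHS]ffunE.
rewrite -[LHS]jK -i0; congr i; apply: th_sep => k.
by apply: (ku (k, x)); rewrite mem_enum.
Qed.

Lemma ideal_bag w : freq_ideal w ->
  exists2 l : bag A, admissible z t l & forall x, w x = bag_sum z i l x.
Proof.
elim=> [|_ v [h [s [fh ps ->]]] _ [l adm lE]].
  by exists (fun=> [::]) => // x; rewrite bag_sum_nil ffunE.
exists (bag_cat (bag_one h s) l).
  by apply: admissible_cat => //; apply: admissible_one.
by move=> x; rewrite bag_sum_cat bag_sum_one !ffunE lE /linpart iK.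
Qed.

Lemma maltsev_from_module : has_maltsev_poly A.
Proof.
pose proj n (lt : (n < 3)%N) : Y := [ffun x : Om => nth z [:: x.1.1; x.1.2; x.2] n].
have polyproj n (lt : (n < 3)%N) : poly3 (proj n lt).
  rewrite /poly3; set F := (F in is_poly F).
  have -> : F = fun v => v (Ordinal lt).
    apply: functional_extensionality => v; rewrite /F ffunE /=.
    by case: n lt {F} => [|[|[|n]]] lt //=; congr v; apply: val_inj.
  exact: poly_proj.
(* The constant [t0] is subtracted because [bag_realized] adds it back. *)
pose target := embed (proj 0 isT) - embed (proj 1 isT) + embed (proj 2 isT)
  - embed [ffun=> t0].
have /poly_module_ideal/ideal_bag[l adm lE] : poly_module target.
  apply: span_add; last by apply: poly_moduleN; apply: poly_module_embed; apply: poly3_const.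
  apply: span_add; last exact: poly_module_embed.
  apply: span_add; first exact: poly_module_embed.
  by apply: poly_moduleN; apply: poly_module_embed.
have [M polyM ME] := bag_realized polyt adm.
have iM x : i (M x) = i x.1.1 - i x.1.2 + i x.2.
  by rewrite (ME Z i coord_i) -lE !ffunE addrC subrK.
exists (fun v => M (v ord0, v (@Ordinal 3 1 isT), v (@Ordinal 3 2 isT))); split=> // x y.
rewrite /trip /=; split; apply: (can_inj iK); rewrite iM /=.
  by rewrite subrK.
by rewrite subrr add0r.
Qed.

End Kernels.
End Module.

Local Close Scope ring_scope.

(** * Term from polynomial, exclusion of the unary type, and the conclusion *)

Section Assembly.
Variable A : algebra.
Local Notation T := (carrier A).

Lemma abelian_term_condition m n (t : ('I_(m + n) -> T) -> T) a a' b b' :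
  abelian A -> is_term t ->
  t (catf a b) = t (catf a b') -> t (catf a' b) = t (catf a' b').
Proof.
move=> abA termt eqt; apply/abA => d congd cent.
by apply: (cent _ _ t termt a) => //; rewrite eqt; apply: cong_refl.
Qed.

(* The parameters of the Maltsev polynomial are replaced by the first variable; the
   permutation [x |-> m(x,x,x)] that results is undone by a power of itself. *)
Lemma maltsev_term_of_poly : abelian A -> has_maltsev_poly A -> has_maltsev_term A.
Proof.
move=> abA [m [/poly_term[t [termt mE]] maltm]].
pose q x y z (w : 'I_#|T| -> T) := t (catf (trip x y z) w).
pose c : 'I_#|T| -> T := fun i => enum_val i.
have q1 x y : q x y y c = x by rewrite /q -mE; case: (maltm x y).
have q2 x y : q y y x c = x by rewrite /q -mE; case: (maltm x y).
have tc w w' x y z x' y' z' : q x y z w = q x' y' z' w -> q x y z w' = q x' y' z' w'.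
  pose s (k : 'I_(3 + #|T|)) : ('I_(#|T| + 3) -> T) -> T := fun v =>
    match split k with inl l => v (rshift _ l) | inr l => v (lshift _ l) end.
  have sE u v : t (fun k => s k (catf v u)) = t (catf u v).
    congr t; apply: functional_extensionality => k; rewrite /s /catf.
    by case: (split k) => l; rewrite ?catf_rshift ?catf_lshift // -/(catf v u _)
      ?catf_rshift ?catf_lshift.
  have terms : is_term (fun v => t (fun k => s k v)).
    by apply: is_term_comp => // k; rewrite /s; case: (split k) => l; apply: term_proj.
  have := @abelian_term_condition _ _ _ w w' (trip x y z) (trip x' y' z') abA terms.
  by rewrite !sE.
have termq k (F G H W : ('I_k -> T) -> T) : is_term F -> is_term G -> is_term H -> is_term W ->
    is_term (fun v => q (F v) (G v) (H v) (fun=> W v)).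
  move=> tF tG tH tW.
  apply: (is_term_comp (g := fun l v =>
    catf (trip (F v) (G v) (H v)) (fun=> W v) l) termt) => l.
  rewrite /catf; case: (split l) => [[[|[|[|p]]] lt]|_] //.
pose g w v := q v v v w.
pose N := #|T|`!.
pose i1 : 'I_3 := @Ordinal 3 1 isT; pose i2 : 'I_3 := @Ordinal 3 2 isT.
have gN w x : iter N.-1 (g w) (g w x) = x.
  rewrite (iter_predK (g w) x (fact_gt0 _)).2.
  by apply: (iter_fact_id (U := fun=> True)) => // y z _ _ /(tc w c); rewrite !q1.
exists (fun v => iter N.-1 (g (fun=> v ord0)) (q (v ord0) (v i1) (v i2) (fun=> v ord0))).
split.
  elim: N.-1 => [|n IHn] /=; first by apply: termq; apply: term_proj.
  by apply: termq => //; apply: term_proj.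
move=> x y; rewrite /trip /=; split.
  have -> : q x y y (fun=> x) = g (fun=> x) x by apply: (tc c); rewrite !q1.
  exact: gN.
have -> : q y y x (fun=> y) = g (fun=> y) x by apply: (tc c); rewrite q2 q1.
exact: gN.
Qed.

(** A frequent slice belongs to two variables. If [e] after [t] ignores one of them modulo [th],
    equality of the slices makes it ignore the other, and [twin_full] extends this from the constant
    tuple to all contexts. A class of [th] then gives a colouring that contradicts [rich]. *)
Lemma not_essentially_unary (th : T -> T -> Prop) (e : T -> T) (z : T) N m
    (t : ('I_m -> T) -> T) :
  is_maximal_cong th -> minimal_idem th e -> solvable A -> 1 < N -> is_poly t ->
  (forall chi : T -> bool,
     (forall x y, (forall i, ~~ frequent z N t (slice z t i) -> x i = y i) ->
        chi (t x) = chi (t y)) ->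
     forall a b, chi a = chi b) ->
  ~ essentially_unary th e.
Proof.
move=> max_th min_e solvA N1 polyt rich unary.
have congth : is_cong th by case: max_th.
have [upe eK [x0 [y0 nth]] _] := min_e.
have cst_slice i : frequent z N t (slice z t i) ->
    forall a b, th (e (slice z t i a)) (e (slice z t i b)).
  move=> fi; have [k neq eqs] : exists2 k, k != i & slice z t k = slice z t i.
    apply: NNPP => none; move: fi; rewrite /frequent leqNgt => /negP; apply.
    apply: leq_ltn_trans N1; rewrite -(card1 i); apply: subset_leq_card.
    apply/subsetP => k; rewrite !inE => /eqP eqs; apply: contraT => neq.
    by case: none; exists k.
  have bpp : bp (fun x y => e (t (upd (upd (fun=> z) i x) k y))).
    by apply: (up_app upe); apply: (bp_upd (fun=> z) i k polyt).
  have nki : (k == i) = false by apply/negbTE.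
  have updk x : upd (upd (fun=> z) i x) k z = upd (fun=> z) i x.
    apply: functional_extensionality => l; rewrite /upd.
    by case: (l =P k) => // ->; rewrite nki.
  have [indep|indep] := unary _ bpp (fun x y => eK _) => a b.
    by have := indep a b z; rewrite !updk !ffunE.
  have := indep z a b; rewrite [upd (fun=> z) i z](upd_same (fun=> z) i).
  by rewrite -eqs !ffunE.
have cst_context c i a b : frequent z N t (slice z t i) ->
    th (e (t (upd c i a))) (e (t (upd c i b))).
  move=> fi; move: a b.
  pose Q (d : 'I_m -> T) := forall a b, th (e (t (upd d i a))) (e (t (upd d i b))).
  have Q0 : Q (fun=> z) by move=> a b; have := cst_slice i fi a b; rewrite !ffunE.
  suff : Q (fun=> z) -> Q c by apply.
  apply: (@one_at_a_time _ _ xpredT (fun d d' => Q d -> Q d')) => //.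
    by move=> b a d Qab Qbd /Qab/Qbd.
  move=> d k y _ Qd.
  case: (eqVneq k i) => [->|neq] a b; first by rewrite !upd_upd.
  apply: (@twin_full _ _ _ max_th min_e solvA
    (fun x y => e (t (upd (upd d k y) i x))) y (d k)) => // [|x x'].
    by apply: (up_app upe); apply: (bp_swap (bp_upd d k i polyt)).
  by rewrite upd_same; apply: Qd.
have invariant x y : (forall i, ~~ frequent z N t (slice z t i) -> x i = y i) ->
    th (e (t x)) (e (t y)).
  apply: (@one_at_a_time _ _ (fun i => frequent z N t (slice z t i))
    (fun c c' => th (e (t c)) (e (t c')))) => [c|b a c|c i a fi].
  - exact: (cong_refl congth).
  - exact: (cong_trans congth).
  - by rewrite -{1}(upd_same c i); apply: cst_context.
have /(_ x0 y0) : forall a b, as_bool (th (e a) (e y0)) = as_bool (th (e b) (e y0)).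
  apply: (rich (fun a => as_bool (th (e a) (e y0)))) => x y /invariant thxy.
  apply/as_boolP/as_boolP; last exact: (cong_trans congth thxy).
  by apply: (cong_trans congth); apply: (cong_sym congth).
have /as_boolP -> : th (e y0) (e y0) by apply: (cong_refl congth).
by move/as_boolP.
Qed.

End Assembly.

Theorem theorem8p1 (A : algebra) :
  semisimple A -> solvable A -> dA_linear A ->
  has_maltsev_poly A /\ affine A.
Proof.
move=> ssA solvA linA.
case: (leqP #|carrier A| 1) => [le1|lt1].
  have triv (x y : carrier A) : x = y by move/fintype_le1P: le1; apply.
  have malt (m : ('I_3 -> carrier A) -> carrier A) : is_maltsev m.
    by move=> x y; split; apply: triv.
  split; first by exists (fun v => v ord0); split=> //; apply: poly_proj.
  split; last by exists (fun v => v ord0); split=> //; apply: term_proj.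
  by move=> x y; split=> [_|-> d congd _]; [exact: triv | exact: (cong_refl congd)].
have [z [z' [_ _ neqz]]] : exists x y : carrier A, [/\ x \in predT, y \in predT & x != y].
  by apply/card_gt1P.
pose bound := #|{: {ffun carrier A * carrier A * carrier A -> carrier A}}| * #|carrier A|`!.
have bound1 : 1 < bound.
  apply: (leq_trans lt1); apply: (leq_trans (fact_geq _)); apply: leq_pmull.
  by apply/card_gt0P; exists [ffun=> z].
have [m [t [termt rich]]] := linear_growth_term z bound linA lt1.
have polyt := term_poly termt.
have sep_max (x y : carrier A) : x <> y -> exists2 th, is_maximal_cong th & ~ th x y.
  move=> neq; apply: NNPP => none; apply: neq; apply: ssA => th max_th.
  by apply: NNPP => nth; apply: none; exists th.
(* Indexing by pairs of elements keeps the separating family finite; a diagonal pair receives an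
   arbitrary maximal congruence. *)
have ex_th (p : carrier A * carrier A) :
    exists th, is_maximal_cong th /\ (p.1 <> p.2 -> ~ th p.1 p.2).
  case: (eqVneq p.1 p.2) => [eqp|/eqP neq].
    by have [th max_th _] := sep_max z z' (elimN eqP neqz); exists th.
  by have [th max_th nth] := sep_max _ _ neq; exists th.
have [th thP] := fin_all_exists ex_th.
have max_th p : is_maximal_cong (th p) by case: (thP p).
have th_sep x y : (forall p, th p x y) -> x = y.
  move=> allth; apply: NNPP => neq; case: (thP (x, y)) => _ /(_ neq) /=; apply.
  exact: allth.
have th_coord p : exists (V : zmodType) (f : carrier A -> V),
    coord f /\ forall x y, th p x y <-> forall r, up r -> f (r x) = f (r y).
  have [e min_e] := minimal_idem_exists (max_th p).
  apply: (type_two_coord (max_th p) min_e solvA).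
  exact: (not_essentially_unary (max_th p) min_e solvA bound1 polyt rich).
have reach := all_reachable polyt rich.
have [x y sepxy|Z [i [j [iK jK coord_i i0 coordD]]]] := @affine_group A z m t polyt rich.
  apply: th_sep => p; have [V [f [cf thE]]] := th_coord p; apply/thE => r upr.
  exact: (sepxy V _ (coord_up cf upr)).
have maltA := maltsev_from_module polyt reach iK jK coord_i i0 coordD max_th th_coord th_sep.
have abA : abelian A by apply: (coord_abelian z coord_i (can_inj iK)).
by split=> //; split=> //; apply: maltsev_term_of_poly.
Qed.
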